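(* Let $(Y_1,Z_1),\dots,(Y_N,Z_N)$, the functions $\gamma_i$, $h=(h_1,\dots,h_p)$, the set $D_0$, the integer $m\ge 0$ and the constants $F_m,F_{m+1},a_i,b_i,d_j$ satisfy the Regularity, Boundedness and Parameter Domain assumptions stated in the context. Fix an arbitrary $\theta\in D_0$. Then there is a process $\{\xi(v):v\in D_0\}$ such that for $v\in D_0$, $$\sum_{i=1}^N [\![\gamma_i(h(Z_i)^\top v,Y_i)]\!] = \sum_{k=0}^m\frac1{k!}\sum_{i=1}^N \Big[\!\Big[\frac{\partial^k\gamma_i(h(Z_i)^\top\theta,Y_i)}{\partial t^k}\,[h(Z_i)^\top(v-\theta)]^k\Big]\!\Big]+\xi(v)\Big(\sum_{j=1}^p d_j|v_j-\theta_j|\Big)^m$$ $$=\sum_{k=0}^m\frac1{k!}\sum_{i=1}^N \Big[\!\Big[\frac{\partial^k\gamma_i(h(Z_i)^\top\theta,Y_i)}{\partial t^k}\,h(Z_i)^{\otimes k}\Big]\!\Big]^\top (v-\theta)^{\otimes k}+\xi(v)\Big(\sum_{j=1}^p d_j|v_j-\theta_j|\Big)^m ,$$ and $$\Pr\Big\{\sup_{v\in D_0}|\xi(v)|>A\sqrt{2\ln(2p)}+B\sqrt{2\ln(p^m/q)}+C\ln(p^m/q)\Big\}\le q,\qquad\forall q\in(0,1),$$ where, with $$R=\sup_{u,v\in D_0}\sum_{j=1}^p d_j|u_j-v_j|,\qquad \phi=\min\Big(\frac{2F_m}{m!},\frac{F_{m+1}R}{(m+1)!}\Big),\qquad \psi=\begin{cases}F_{m+1}/m!&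 m\ne1\\ F_{m+1}/2& m=1,\end{cases}$$ one sets $$A=8\psi R\;\mathsf{E}\sqrt{\max_{j\le p}\sum_{i=1}^N[h_j(Z_i)/d_j]^2},\qquad B=\phi\sqrt{\mathsf{E}\max_{j\le p}\sum_{i=1}^N[h_j(Z_i)/d_j]^{2m}},\qquad C=8\phi,$$ with the convention $x^0\equiv1$ in the definition of $B$ when $m=0$.
   Context: Setting. $(Y_1,Z_1),\dots,(Y_N,Z_N)$ are independent (not necessarily identically distributed) random variables with values in a product measurable space $\mathcal Y\times\mathcal Z$. The $\gamma_i:\mathbb R\times\mathcal Y\to\mathbb R$, $i\le N$, are given functions $\gamma_i(t,y)$; $h=(h_1,\dots,h_p):\mathcal Z\to\mathbb R^p$ is a given function; $D_0\subset\mathbb R^p$ is a nonempty set (domain of parameter values). Regularity assumption. There are $m\in\{0,1,2,\dots\}$ and $-\infty\le a_i<b_i\le\infty$, $i\le N$, such that with probability 1 each $\gamma_i(t,Y_i)$, as a function of $t$, is $m$ times differentiable on $(a_i,b_i)$ with the $m$-th derivative bounded and Lipschitz. $F_m,F_{m+1}$ are constants such that with probability 1, for all $t,t'\in(a_i,b_i)$ and $i\le N$, $|\partial^m\gamma_i(t,Y_i)/\partial t^m|\le F_m$ and $|\partial^m\gamma_i(t,Y_i)/\partial t^m-\partial^m\gamma_i(t',Y_i)/\partial t^m|\le F_{m+1}|t-t'|$. Boundedness assumption. There are constants $d_1,\dots,d_p\in(0,\infty)$ with $\Pr\{\max_{i\le N}|h_j(Z_i)|\le d_j\ \forall j\le p\}=1$.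 Parameter Domain assumption. $\Pr\{h(Z_i)^\top v\in(a_i,b_i)\ \forall v\in D_0,\ i\le N\}=1$. Notation. For a random vector $X$, $[\![X]\!]=X-\mathsf E X$ (expectations so appearing are understood to be finite). $\partial^k\gamma_i(s,Y_i)/\partial t^k$ is the $k$-th partial derivative in the first argument evaluated at $s$. For $a\in\mathbb R^m,b\in\mathbb R^n$, $a\otimes b=(a_1b^\top,\dots,a_mb^\top)^\top\in\mathbb R^{mn}$, and $v^{\otimes k}$ is the tensor product of $k$ copies of $v$ ($v^{\otimes0}=1$). If $F_{m+1}>0$ the bound is meaningful only when $R<\infty$; if $F_{m+1}=0$, then $A=B=C=0$ (convention $0\cdot\infty=0$). *)

(* Defs.v *)
From HB Require Import structures.
From mathcomp Require Import all_boot all_order all_algebra.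
From mathcomp Require Import all_classical all_reals all_analysis.

Set Implicit Arguments.
Unset Strict Implicit.
Unset Printing Implicit Defensive.

Import Order.TTheory GRing.Theory Num.Theory.
Import numFieldNormedType.Exports.

Local Open Scope classical_set_scope.
Local Open Scope ring_scope.

Section vectors.
Variable R : realType.

Definition dotv (n : nat) (u v : 'cV[R]_n) : R := (u^T *m v) 0 0.

(* [mxvec] is row-major, so this is (a_1 b^T, ..., a_m b^T)^T. *)
Definition kronv (m n : nat) (a : 'cV[R]_m) (b : 'cV[R]_n) : 'cV[R]_(m * n) :=
  (mxvec (a *m b^T))^T.

(* p ^ k, by a recursion under which the k-fold tensor power needs no cast. *)
Fixpoint tdim (p k : nat) : nat :=
  if k is k'.+1 then (p * tdim p k')%N else 1%N.

Fixpoint tensor_pow (p : nat) (v : 'cV[R]_p) (k : nat) : 'cV[R]_(tdim p k) :=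
  match k with
  | 0 => const_mx 1
  | k'.+1 => kronv v (tensor_pow v k')
  end.

Definition wnorm1 (p : nat) (d : 'I_p -> R) (v : 'cV[R]_p) : R :=
  \sum_(j < p) d j * `|v j 0|.

End vectors.

Section random.
Variables (R : realType) (dO : measure_display) (Omega : measurableType dO)
  (P : probability Omega R).

(* A random variable involving derivatives of the gamma_i is only defined up to
   a null event (the derivatives exist with probability 1), and the value that
   [derive1n] assigns on that event need not be measurable; hence integrability
   is required of some almost sure version. The integral, and so ['E_P[X]],
   does not depend on the version. *)
Definition finite_expectation (X : Omega -> R) : Prop :=
  exists X' : Omega -> R,
    P.-integrable setT (EFin \o X') /\ {ae P, forall w, X w = X' w}.

Definition centered (X : Omega -> R) : Omega -> R :=
  fun w => X w - fine 'E_P[X].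

Definition centeredv (n : nat) (X : Omega -> 'cV[R]_n) : Omega -> 'cV[R]_n :=
  fun w => \col_j centered (fun w' => X w' j 0) w.

Definition mutually_independent (I : finType) (dT : measure_display)
    (T : measurableType dT) (W : I -> Omega -> T) : Prop :=
  forall (J : {set I}) (B : I -> set T),
    (forall i, measurable (B i)) ->
    P (\bigcap_(i in [set` J]) (W i @^-1` B i)) =
    (\prod_(i in J) P (W i @^-1` B i))%E.

End random.

Section setting.
Variables (R : realType) (dO dY dZ : measure_display)
  (Omega : measurableType dO) (Ys : measurableType dY) (Zs : measurableType dZ)
  (P : probability Omega R) (N p : nat)
  (Y : 'I_N -> {RV P >-> Ys}) (Z : 'I_N -> {RV P >-> Zs})
  (gamma : 'I_N -> R -> Ys -> R) (h : Zs -> 'cV[R]_p) (D0 : set 'cV[R]_p)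
  (m : nat) (a b : 'I_N -> \bar R) (Fm Fm1 : R) (d : 'I_p -> R).

Definition dgamma (k : nat) (i : 'I_N) (t : R) (y : Ys) : R :=
  derive1n k (fun s => gamma i s y) t.

Definition inab (i : 'I_N) (t : R) : Prop := (a i < t%:E < b i)%E.

Definition regularity : Prop :=
  (forall i, (a i < b i)%E) /\
  {ae P, forall w, forall i : 'I_N,
    [/\ forall k, (k < m)%N -> forall t, inab i t ->
          derivable (fun s => dgamma k i s (Y i w)) t 1,
        forall t, inab i t -> `|dgamma m i t (Y i w)| <= Fm
      & forall t t', inab i t -> inab i t' ->
          `|dgamma m i t (Y i w) - dgamma m i t' (Y i w)| <= Fm1 * `|t - t'|]}.

Definition boundedness : Prop :=
  (forall j, 0 < d j) /\
  {ae P, forall w, forall (j : 'I_p) (i : 'I_N), `|h (Z i w) j 0| <= d j}.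

Definition parameter_domain : Prop :=
  {ae P, forall w, forall v, D0 v -> forall i, inab i (dotv (h (Z i w)) v)}.

Definition finite_expectations (theta : 'cV[R]_p) : Prop :=
  [/\ forall i v, D0 v ->
        finite_expectation P (fun w => gamma i (dotv (h (Z i w)) v) (Y i w)),
      forall i k v, (k <= m)%N -> D0 v ->
        finite_expectation P (fun w =>
          dgamma k i (dotv (h (Z i w)) theta) (Y i w) *
          dotv (h (Z i w)) (v - theta) ^+ k)
    & forall i k (J : 'I_(tdim p k)), (k <= m)%N ->
        finite_expectation P (fun w =>
          dgamma k i (dotv (h (Z i w)) theta) (Y i w) *
          tensor_pow (h (Z i w)) k J 0)].

Definition gamma_sum (v : 'cV[R]_p) (w : Omega) : R :=
  \sum_(i < N) centered P (fun w' => gamma i (dotv (h (Z i w')) v) (Y i w')) w.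

Definition taylor_sum (theta v : 'cV[R]_p) (w : Omega) : R :=
  \sum_(k < m.+1) k`!%:R^-1 *
    \sum_(i < N) centered P (fun w' =>
      dgamma k i (dotv (h (Z i w')) theta) (Y i w') *
      dotv (h (Z i w')) (v - theta) ^+ k) w.

Definition tensor_taylor_sum (theta v : 'cV[R]_p) (w : Omega) : R :=
  \sum_(k < m.+1) k`!%:R^-1 *
    \sum_(i < N) dotv
      (centeredv P (fun w' =>
        dgamma k i (dotv (h (Z i w')) theta) (Y i w') *:
        tensor_pow (h (Z i w')) k) w)
      (tensor_pow (v - theta) k).

(* The constants live in \bar R because the diameter may be +oo; there
   0 * +oo = 0. *)
Local Open Scope ereal_scope.

Definition diam : \bar R :=
  ereal_sup [set (wnorm1 d (uv.1 - uv.2))%:E | uv in D0 `*` D0].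

Definition phi : \bar R :=
  mine (2 * Fm / m`!%:R)%:E ((Fm1 / m.+1`!%:R)%:E * diam).

Definition psi : R := if m == 1%N then (Fm1 / 2)%R else (Fm1 / m`!%:R)%R.

Definition max_power_sum (r : nat) (w : Omega) : R :=
  (\big[Num.max/0]_(j < p) \sum_(i < N) (h (Z i w) j 0 / d j) ^+ r)%R.

Definition constA : \bar R :=
  (8 * psi)%:E * diam * 'E_P[fun w => Num.sqrt (max_power_sum 2 w)].

Definition constB : \bar R := phi * sqrte 'E_P[max_power_sum (2 * m)].

Definition constC : \bar R := 8%:E * phi.

Definition tail_threshold (q : R) : \bar R :=
  constA * (Num.sqrt (2 * ln (2 * p%:R)))%:E
  + constB * (Num.sqrt (2 * ln (p%:R ^+ m / q)))%:E
  + constC * (ln (p%:R ^+ m / q))%:E.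

End setting.

(* Main.v *)
Require Import Defs.
From HB Require Import structures.
From mathcomp Require Import all_boot all_order all_algebra.
From mathcomp Require Import all_classical all_reals all_analysis.
From mathcomp Require Import measurable_realfun.
From mathcomp Require Import ring lra.

(* Divide the m-th order Taylor remainder of gamma_i at h(Z_i)^T theta by
   [h(Z_i)^T (v - theta)]^m. The quotient rho_i(v) is bounded by phi and, as a function of
   h(Z_i)^T v, Lipschitz with constant L = Fm1 / (m + 1)! <= psi. Expanding the m-th power,
   |xi(v)| is at most the maximum over the p^m multi-indices J of
   |sum_i [[rho_i(v) prod_l h_(J l)(Z_i) / d_(J l)]]|, and it remains to bound the supremum
   over v for each J with confidence q / p^m. Symmetrization, contraction and a maximal
   inequality for Rademacher averages bound its mean by A sqrt(2 ln(2p)); since the summands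
   are dominated uniformly in v by phi prod_l |h_(J l)(Z_i) / d_(J l)|, a Bernstein type
   martingale argument bounds the deviation from the mean by
   B sqrt(2 ln(p^m / q)) + C ln(p^m / q).

   To avoid conditional expectations and product spaces, these probabilistic
   estimates are proved for variables with finitely many values, where means are iterated
   finite sums, and transferred by discretizing the (Y_i, Z_i) and letting the mesh tend
   to 0. Uncountable suprema are reduced to countable ones by continuity of xi in v. *)

Set Implicit Arguments.
Unset Strict Implicit.
Unset Printing Implicit Defensive.

Import Order.TTheory GRing.Theory Num.Theory.
Import numFieldNormedType.Exports.

Local Open Scope classical_set_scope.
Local Open Scope ring_scope.

(** * Sup norms and iterated means *)

(** The obstacle is the m-th power in the remainder: the contraction principle compares with a
    process that is linear in v. Dividing by that power leaves a quotient that vanishes at v = theta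
    and is L-Lipschitz in h(Z_i)^T v. The expansion then splits the power into weights prod_l h_(J
    l)(Z_i) / d_(J l), which are free of v and bounded by 1, and coefficients whose absolute values
    add up to the normalizing factor (sum_j d_j |v_j - theta_j|)^m. Since the weights are at most 1,
    one linear comparison process serves every J, so the bound on the mean does not depend on J. The
    weights matter only in the variance, where the AM-GM inequality replaces their mixed products by
    the pure powers that appear in B.

    The 8 in A is 2 * 2 * 2: one factor for symmetrization, one for writing an absolute value as two
    one-sided maxima, and one for a crude bound on cosh. *)

Section sup_norm.
Variables (R : realType) (V : finType).
Implicit Types x y : {ffun V -> R}.

(** The default value 0 makes this the maximum of the positive parts. The one-sided form is needed
    because [contracting] fails for [supn]: take x = (1, -1), f = (1, 1), t = (1, -1). *)
Definition supp x : R := \big[Num.max/0]_v x v.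

Definition supn x : R := \big[Num.max/0]_v `|x v|.

Lemma supp_ge0 x : 0 <= supp x.
Proof. exact: bigmax_ge_id. Qed.

Lemma supp_ge x v : x v <= supp x.
Proof. exact: le_bigmax. Qed.

Lemma supn_ge0 x : 0 <= supn x.
Proof. exact: bigmax_ge_id. Qed.

Lemma supn_ge x v : `|x v| <= supn x.
Proof. exact: (le_bigmax _ (fun v => `|x v|)). Qed.

Lemma supn_le x c : 0 <= c -> (forall v, `|x v| <= c) -> supn x <= c.
Proof. by move=> c0 xc; apply: bigmax_le. Qed.

Lemma supp_le_supn x : supp x <= supn x.
Proof.
apply: bigmax_le; first exact: supn_ge0.
by move=> v _; apply: le_trans (supn_ge x v); exact: ler_norm.
Qed.

Lemma suppN_le_supn x : supp (- x) <= supn x.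
Proof.
apply: bigmax_le; first exact: supn_ge0.
by move=> v _; rewrite ffunE (le_trans _ (supn_ge x v))// -normrN ler_norm.
Qed.

Lemma supn_le_supp x : supn x <= supp x + supp (- x).
Proof.
apply: supn_le => [|v]; first by rewrite addr_ge0 ?supp_ge0.
have := supp_ge x v; have := supp_ge (- x) v; rewrite ffunE.
have := supp_ge0 x; have := supp_ge0 (- x).
by rewrite ler_norml; lra.
Qed.

Lemma supnZ (c : R) x : 0 <= c -> supn (c *: x) <= c * supn x.
Proof.
move=> c0; apply: supn_le => [|v]; first by rewrite mulr_ge0 ?supn_ge0.
by rewrite ffunE normrM (ger0_norm c0) ler_wpM2l ?supn_ge.
Qed.

Lemma supn_lip x y : `|supn x - supn y| <= supn (x - y).
Proof.
have aux (a b : {ffun V -> R}) : supn a <= supn b + supn (a - b).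
  apply: supn_le => [|v]; first by rewrite addr_ge0 ?supn_ge0.
  apply: le_trans (lerD (supn_ge b v) (supn_ge (a - b) v)).
  by rewrite !ffunE (le_trans _ (ler_normD _ _))// addrC subrK.
rewrite ler_norml; have := aux x y; have := aux y x.
suff -> : supn (y - x) = supn (x - y) by lra.
by apply: eq_bigr => v _; rewrite !ffunE distrC.
Qed.

Lemma bigmax_attained (I : finType) (F : I -> R) :
  \big[Num.max/0]_i F i = 0 \/ exists i, \big[Num.max/0]_i F i = F i.
Proof.
apply: (big_ind (fun m => m = 0 \/ exists i, m = F i)); [by left| |].
- by move=> a b; rewrite /Num.max; case: ifP.
- by move=> i _; right; exists i.
Qed.

End sup_norm.

Section iterated_mean.
Variables (R : realType) (A V : finType).
Implicit Types (q : nat -> A -> R) (g : nat -> A -> {ffun V -> R}).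
Implicit Types (H : {ffun V -> R} -> R) (x y : {ffun V -> R}).

Definition pmf (B : finType) (p : B -> R) :=
  (forall b, 0 <= p b) /\ \sum_b p b = 1.

(** The argument [x] collects the contributions of the variables already fixed, so
    [itmean q g k H x] plays the part of the conditional mean given the variables of index at least
    k. *)
Fixpoint itmean q g n H x : R :=
  if n is n'.+1 then \sum_a q n' a * itmean q g n' H (x + g n' a) else H x.

Definition prodmean q n (F : {ffun 'I_n -> A} -> R) : R :=
  \sum_(s : {ffun 'I_n -> A}) (\prod_(i < n) q i (s i)) * F s.

Lemma big_ffun_recr (n : nat) (F : {ffun 'I_n.+1 -> A} -> R) :
  \sum_s F s =
  \sum_a \sum_(s : {ffun 'I_n -> A}) F [ffun i => oapp s a (unlift ord_max i)].
Proof.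
rewrite pair_big /=.
rewrite (reindex (fun p : A * {ffun 'I_n -> A} =>
  [ffun i => oapp p.2 p.1 (unlift ord_max i)])) //=.
exists (fun s => (s ord_max, [ffun i => s (lift ord_max i)])).
- move=> [a s] _ /=; rewrite ffunE unlift_none /=; congr (_, _).
  by apply/ffunP => i; rewrite !ffunE liftK.
- move=> s _; apply/ffunP => i; rewrite ffunE /=.
  by case: unliftP => [j ->|->] /=; rewrite ?ffunE.
Qed.

Lemma itmeanE q g n H x :
  itmean q g n H x = prodmean q (fun s : {ffun 'I_n -> A} => H (x + \sum_(i < n) g i (s i))).
Proof.
elim: n x => [|n IH] x /=; rewrite /prodmean.
  transitivity (\sum_(s : {ffun 'I_0 -> A}) H x).
    by rewrite sumr_const card_ffun card_ord expn0 mulr1n.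
  by apply: eq_bigr => s _; rewrite !big_ord0 mul1r addr0.
rewrite big_ffun_recr; apply: eq_bigr => a _.
rewrite IH /prodmean big_distrr /=; apply: eq_bigr => s _.
have e (i : 'I_n) : [ffun i => oapp s a (unlift ord_max i)]
    (widen_ord (leqnSn n) i) = s i.
  have -> : widen_ord (leqnSn n) i = lift ord_max i.
    by apply: val_inj; rewrite /= /bump leqNgt ltn_ord.
  by rewrite ffunE liftK.
rewrite !big_ord_recr /= ffunE unlift_none /=.
rewrite [_ * q n a]mulrC mulrA; congr (_ * _ * H _).
  by apply: eq_bigr => i _; rewrite e.
by rewrite -addrA [g n a + _]addrC; congr (_ + (_ + _)); apply: eq_bigr => i _; rewrite e.
Qed.

Section pmfs.
Variables (q : nat -> A -> R).
Hypothesis q_pmf : forall n, pmf (q n).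

Lemma wsum_le n (F G : A -> R) : (forall a, F a <= G a) ->
  \sum_a q n a * F a <= \sum_a q n a * G a.
Proof. by move=> FG; apply: ler_sum => a _; rewrite ler_wpM2l// (q_pmf n).1. Qed.

Lemma wsum_const n (c : R) : \sum_a q n a * c = c.
Proof. by rewrite -big_distrl /= (q_pmf n).2 mul1r. Qed.

Lemma le_prodmean n (F G : {ffun 'I_n -> A} -> R) :
  (forall s, F s <= G s) -> prodmean q F <= prodmean q G.
Proof.
move=> FG; apply: ler_sum => s _; rewrite ler_wpM2l//.
by apply: prodr_ge0 => i _; exact: (q_pmf i).1.
Qed.

Lemma prodmean_const n (c : R) : prodmean q (fun _ : {ffun 'I_n -> A} => c) = c.
Proof.
rewrite /prodmean -big_distrl /=.
rewrite -(bigA_distr_bigA (fun (i : 'I_n) a => q i a)) /=.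
by rewrite big1 ?mul1r// => i _; exact: (q_pmf i).2.
Qed.

Lemma le_itmean g n H1 H2 x :
  (forall y, H1 y <= H2 y) -> itmean q g n H1 x <= itmean q g n H2 x.
Proof. by move=> H12; elim: n x => //= n IH x; apply: wsum_le => a. Qed.

Definition lip1 H := forall x y, `|H x - H y| <= supn (x - y).

Lemma itmean_lip1 g n H : lip1 H -> lip1 (itmean q g n H).
Proof.
move=> HL; elim: n => [//|n IH] x y /=.
rewrite -sumrB -[leRHS](wsum_const n).
apply: le_trans (ler_norm_sum _ _ _) _; apply: ler_sum => a _.
rewrite -mulrBr normrM (ger0_norm ((q_pmf n).1 a)) ler_wpM2l ?(q_pmf n).1//.
by apply: le_trans (IH _ _) _; rewrite opprD addrACA subrr addr0.
Qed.

(** Convexity, stated for finite means. Like [lip1] and [contracting], it passes from [H] to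
    [itmean q g n H]; inductions on the number of variables can therefore use it for the mean over
    the variables not yet treated. *)
Definition jensen H := forall (B : finType) (p : B -> R) (y : B -> {ffun V -> R}),
  pmf p -> H (\sum_b p b *: y b) <= \sum_b p b * H (y b).

Lemma supn_jensen : jensen (@supn R V).
Proof.
move=> B p y [p0 p1]; apply: supn_le => [|v].
  by apply: sumr_ge0 => b _; rewrite mulr_ge0 ?supn_ge0.
rewrite sum_ffunE (le_trans (ler_norm_sum _ _ _))//.
by apply: ler_sum => b _; rewrite ffunE normrM (ger0_norm (p0 b)) ler_wpM2l ?supn_ge.
Qed.

Lemma itmean_jensen g n H : jensen H -> jensen (itmean q g n H).
Proof.
move=> HJ; elim: n => [//|n IH] B p y ppmf /=.
under [leRHS]eq_bigr do rewrite big_distrr /=.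
rewrite exchange_big /=; apply: ler_sum => a _.
under [leRHS]eq_bigr do rewrite mulrCA.
rewrite -big_distrr /= ler_wpM2l ?(q_pmf n).1//.
have {1}-> : g n a = \sum_b p b *: g n a by rewrite -scaler_suml ppmf.2 scale1r.
rewrite -big_split /=; apply: le_trans (IH _ _ (fun b => y b + g n a) ppmf).
by under eq_bigr do rewrite -scalerDr.
Qed.

Lemma jensen_mid H x y : jensen H -> H (2^-1 *: (x + y)) <= 2^-1 * (H x + H y).
Proof.
move=> HJ; have := HJ bool (fun=> 2^-1) (fun b => if b then x else y).
rewrite !big_bool /= -scalerDr -mulrDr; apply; split=> //.
by rewrite big_bool /=; lra.
Qed.

(* The cross condition is what is compared when the two maxima in
   [supp (x + f) + supp (x - f)] are attained at different indices. *)
Definition dominated (f t : {ffun V -> R}) :=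
  (forall v, `|f v| <= `|t v|) /\ forall v w, `|f v - f w| <= `|t v - t w|.

Definition contracting H := forall x f t, dominated f t ->
  H (x + f) + H (x - f) <= H (x + t) + H (x - t).

(** If the maxima on the left are attained at v and w, the left side is x v + x w + (f v - f w), at
    most x v + x w + |t v - t w|. The right side dominates this by evaluating its two maxima at v
    and w in the order given by the sign of t v - t w. If one maximum is the default 0, the bound
    |f| <= |t| at the other index is enough. *)
Lemma supp_contracting : contracting (@supp R V).
Proof.
move=> x f t [ft1 ft2].
have P1 := supp_ge (x + t); have P2 := supp_ge (x - t).
have N1 := supp_ge0 (x + t); have N2 := supp_ge0 (x - t).
have ab (z : R) : (`|z| = z \/ `|z| = - z) /\ z <= `|z| /\ - z <= `|z|.
  split; last by split; [exact: ler_norm|rewrite -normrN; exact: ler_norm].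
  by case: (leP 0 z) => z0; [left; rewrite ger0_norm|right; rewrite ltr0_norm].
case: (bigmax_attained (fun v => (x + f) v)) => [E1|[v E1]];
case: (bigmax_attained (fun v => (x - f) v)) => [E2|[w E2]];
  rewrite [X in X + _ <= _]/supp E1 [X in _ + X <= _]/supp E2.
- by lra.
- move: (P1 w) (P2 w) (ft1 w); rewrite !ffunE.
  have [[] + [_ _]] := ab (t w); have [_ [? ?]] := ab (f w); lra.
- move: (P1 v) (P2 v) (ft1 v); rewrite !ffunE.
  have [[] + [_ _]] := ab (t v); have [_ [? ?]] := ab (f v); lra.
- move: (P1 v) (P2 v) (P1 w) (P2 w) (ft2 v w); rewrite !ffunE.
  have [[] + [_ _]] := ab (t v - t w); have [_ [? ?]] := ab (f v - f w); lra.
Qed.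

Lemma contractingN H : contracting H -> contracting (fun x => H (- x)).
Proof.
move=> HC x f t ft; rewrite !opprD !opprK.
by rewrite addrC [leRHS]addrC; exact: HC.
Qed.

Lemma contractingD H1 H2 : contracting H1 -> contracting H2 ->
  contracting (fun x => H1 x + H2 x).
Proof.
by move=> HC1 HC2 x f t ft; rewrite addrACA [leRHS]addrACA lerD ?HC1 ?HC2.
Qed.

Lemma itmean_contracting g n H : contracting H -> contracting (itmean q g n H).
Proof.
move=> HC; elim: n => [//|n IH] x f t ft /=.
rewrite -!big_split /=; apply: ler_sum => a _; rewrite -!mulrDr ler_wpM2l//.
  exact: (q_pmf n).1.
have e z : x + z + g n a = (x + g n a) + z by rewrite addrAC.
by rewrite !e; exact: IH.
Qed.

End pmfs.
End iterated_mean.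

(** * Symmetrization and contraction *)

Section symmetrization.
Variables (R : realType) (A V : finType).
Variables (q : nat -> A -> R) (q_pmf : forall n, pmf (q n)).
Implicit Types (f t : nat -> A -> {ffun V -> R}) (x : {ffun V -> R}).

Definition qsign n (p : A * bool) : R := q n p.1 / 2.

Definition fsign f n (p : A * bool) : {ffun V -> R} := (-1) ^+ p.2 *: f n p.1.

Definition fmean f n : {ffun V -> R} := \sum_a q n a *: f n a.

Definition fcent f n a : {ffun V -> R} := f n a - fmean f n.

Lemma qsign_pmf n : pmf (qsign n).
Proof.
split=> [[a b]|]; first by rewrite /qsign divr_ge0 ?(q_pmf n).1.
rewrite -(pair_big predT predT (fun a b => qsign n (a, b))) /= -[RHS](q_pmf n).2.
by apply: eq_bigr => a _; rewrite big_bool /= /qsign /=; lra.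
Qed.

Lemma itmean_sign f n H x :
  itmean qsign (fsign f) n.+1 H x = \sum_a q n a * (2^-1 *
    (itmean qsign (fsign f) n H (x + f n a) + itmean qsign (fsign f) n H (x - f n a))).
Proof.
rewrite /= -(pair_big predT predT (fun a b =>
  qsign n (a, b) * itmean qsign (fsign f) n H (x + fsign f n (a, b)))) /=.
apply: eq_bigr => a _; rewrite big_bool /= /qsign /fsign /=.
by rewrite expr1 expr0 scale1r scaleN1r; lra.
Qed.

(* No ghost sample is needed: [x + U - E U] is the midpoint of [x + 2 U] and [x - 2 E U],
   and Jensen's inequality replaces [E U] by [U] in the second point. *)
Lemma symmetrize f n x :
  itmean q (fcent f) n (@supn R V) x <=
  itmean qsign (fsign (fun k a => 2 *: f k a)) n (@supn R V) x.
Proof.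
elim: n x => [//|n IH] x; rewrite itmean_sign /=.
set K := itmean qsign _ n _.
have KJ : jensen K by apply: itmean_jensen; [exact: qsign_pmf|exact: supn_jensen].
apply: (@le_trans _ _ (\sum_a q n a * (2^-1 * (K (x + 2 *: f n a) +
    \sum_b q n b * K (x - 2 *: f n b))))).
  apply: wsum_le => // a; apply: le_trans (IH _) _; rewrite -/K.
  have -> : x + fcent f n a =
      2^-1 *: ((x + 2 *: f n a) + (x - 2 *: fmean f n)).
    by apply/ffunP => v; rewrite !ffunE /GRing.scale /=; lra.
  apply: le_trans (jensen_mid _ _ KJ) _; rewrite ler_wpM2l// lerD2l.
  apply: le_trans (KJ _ _ (fun b => x - 2 *: f n b) (q_pmf n)).
  rewrite le_eqVlt; apply/orP; left; apply/eqP; congr K.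
  under eq_bigr do rewrite scalerBr scalerA mulrC -scalerA.
  by rewrite sumrB -scaler_suml (q_pmf n).2 scale1r -scaler_sumr.
(* The mean over b does not depend on a, so the outer mean leaves it unchanged and the points with
   sign + and sign - are averaged over the same variable. *)
rewrite le_eqVlt; apply/orP; left; apply/eqP.
transitivity (\sum_a (q n a * (2^-1 * K (x + 2 *: f n a)) +
    q n a * (2^-1 * \sum_b q n b * K (x - 2 *: f n b)))).
  by apply: eq_bigr => a _; rewrite -!mulrDr.
under [RHS]eq_bigr do rewrite 2!mulrDr.
rewrite !big_split /=; congr (_ + _).
rewrite wsum_const// big_distrr /=.
by apply: eq_bigr => a _; rewrite mulrCA.
Qed.

(** Summands are exchanged one at a time: the induction hypothesis treats the inner variables at x +
    f and x - f, and then [contracting], applied to the mean over those variables, exchanges the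
    outermost f for t. *)
Lemma contract f t n H x : contracting H ->
  (forall k a, dominated (f k a) (t k a)) ->
  itmean qsign (fsign f) n H x <= itmean qsign (fsign t) n H x.
Proof.
move=> HC ft; elim: n x => [//|n IH] x; rewrite !itmean_sign.
apply: wsum_le => // a; rewrite ler_wpM2l//.
apply: (le_trans (lerD (IH _) (IH _))).
by apply: itmean_contracting => //; exact: qsign_pmf.
Qed.

Lemma dominatedZ (c : R) (f t : {ffun V -> R}) : 0 <= c ->
  dominated f t -> dominated (c *: f) (c *: t).
Proof.
move=> c0 [ft1 ft2]; split=> [v|v w]; rewrite !ffunE /GRing.scale /= -?mulrBr.
  by rewrite !normrM ler_wpM2l.
by rewrite !normrM ler_wpM2l.
Qed.

(** The constant 4 is a factor 2 from [symmetrize] and a factor 2 from [supn y <= supp y + supp (-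
    y) <= 2 * supn y], whose middle term is the functional to which contraction applies. *)
Lemma mean_supn_fcent f t n : (forall k a, dominated (f k a) (t k a)) ->
  itmean q (fcent f) n (@supn R V) 0 <=
  4 * itmean qsign (fsign t) n (@supn R V) 0.
Proof.
move=> ft; apply: le_trans (symmetrize _ _ _) _.
pose H := fun x : {ffun V -> R} => supp x + supp (- x).
have HC : contracting H.
  by apply: contractingD (contractingN _); exact: supp_contracting.
apply: le_trans (le_itmean qsign_pmf _ _ _ (H2 := H) _) _.
  by move=> y; exact: supn_le_supp.
apply: le_trans (contract (t := fun k a => 2 *: t k a) _ _ HC _) _.
  by move=> k a; exact: dominatedZ.
rewrite itmeanE.
apply: (@le_trans _ _ (prodmean qsign (fun s : {ffun 'I_n -> A * bool} =>
   4 * supn (0 + \sum_(i < n) fsign t i (s i))))); last first.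
  rewrite itmeanE /prodmean big_distrr /= le_eqVlt; apply/orP; left; apply/eqP.
  by apply: eq_bigr => s _; rewrite mulrCA.
apply: le_prodmean => [|s]; first exact: qsign_pmf.
rewrite !add0r.
have -> : \sum_(i < n) fsign (fun k a => 2 *: t k a) i (s i) =
    2 *: \sum_(i < n) fsign t i (s i).
  rewrite scaler_sumr; apply: eq_bigr => i _.
  by rewrite /fsign !scalerA [_ * 2]mulrC.
set y := \sum_i _.
have := supp_le_supn (2 *: y); have := suppN_le_supn (2 *: y).
have := supnZ y (ler0n R 2); rewrite /H; lra.
Qed.

(** Conditioning on the values s leaves independent uniform signs, the situation of
    [rademacher_max]. *)
Lemma prodmean_sign n (F : {ffun 'I_n -> A * bool} -> R) :
  prodmean qsign F = prodmean q (fun s : {ffun 'I_n -> A} =>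
    prodmean (fun _ (_ : bool) => 2^-1)
      (fun e : {ffun 'I_n -> bool} => F [ffun i => (s i, e i)])).
Proof.
rewrite /prodmean.
under [RHS]eq_bigr do rewrite big_distrr /=.
rewrite pair_big /=.
rewrite (reindex (fun p : {ffun 'I_n -> A} * {ffun 'I_n -> bool} =>
  [ffun i => (p.1 i, p.2 i)])) /=; last first.
  exists (fun s => ([ffun i => (s i).1], [ffun i => (s i).2])).
    by move=> [s e] _ /=; congr (_, _); apply/ffunP => i; rewrite !ffunE.
  by move=> s _; apply/ffunP => i; rewrite !ffunE -surjective_pairing.
apply: eq_bigr => -[s e] _ /=; rewrite mulrA; congr (_ * _).
by rewrite -big_split /=; apply: eq_bigr => i _; rewrite ffunE.
Qed.

End symmetrization.

(** * Scalar inequalities and Rademacher maxima *)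

Section scalar_bounds.
Variable R : realType.
Implicit Types (f : R -> R) (s t c : R).

Lemma is_derive_shiftX n s t :
  is_derive t 1 (fun u : R => (u - s) ^+ n.+1) (n.+1%:R * (t - s) ^+ n).
Proof.
have d1 : is_derive t 1 (fun u : R => u - s) 1.
  have := is_deriveB (is_derive_id t (1 : R)) (is_derive_cst s t (1 : R)).
  by rewrite subr0.
have -> : (fun u : R => (u - s) ^+ n.+1) = (fun u : R => u - s) ^+ n.+1.
  by apply/funext => u; rewrite exprfctE.
have := is_deriveX n.+1 d1; by rewrite /GRing.scale /= mulr1.
Qed.

(* Rolle's theorem for [f u * (t - s)^(n+1) - f t * (u - s)^(n+1)], which handles both
   orders of [s] and [t] at once. *)
Lemma growth_bound f s t c n :
  (forall u, Num.min s t <= u <= Num.max s t -> derivable f u 1) ->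
  f s = 0 ->
  (forall u, Num.min s t <= u <= Num.max s t -> `|derive1 f u| <= c * `|u - s| ^+ n) ->
  `|f t| <= c * `|t - s| ^+ n.+1 / n.+1%:R.
Proof.
move=> df fs0 f'c; have [->|st] := eqVneq t s.
  by rewrite fs0 subrr normr0 expr0n/= mulr0 mul0r.
pose h u := f u * (t - s) ^+ n.+1 - f t * (u - s) ^+ n.+1.
have dh u : Num.min s t <= u <= Num.max s t ->
    is_derive u 1 h (derive1 f u * (t - s) ^+ n.+1 - f t * (n.+1%:R * (u - s) ^+ n)).
  move=> us.
  have d1 : is_derive u 1 f (derive1 f u) by rewrite derive1E; apply/derivableP/df.
  have d2 := is_derive_shiftX n s u.
  have d3 : is_derive u 1 (fun u => f u * (t - s) ^+ n.+1) (derive1 f u * (t - s) ^+ n.+1).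
    have := is_deriveM d1 (is_derive_cst ((t - s) ^+ n.+1) u (1 : R)).
    by move/is_derive_eq; apply; rewrite scaler0 add0r mulrC.
  have d4 : is_derive u 1 (fun u => f t * (u - s) ^+ n.+1) (f t * (n.+1%:R * (u - s) ^+ n)).
    exact: (is_deriveZ (f t) d2).
  exact: (is_deriveB d3 d4).
have hs : h s = 0 by rewrite /h fs0 mul0r subrr expr0n/= mulr0 subrr.
have ht : h t = 0 by rewrite /h subrr.
pose lo := Num.min s t; pose hi := Num.max s t.
have lohi : lo < hi.
  by move: st; rewrite /lo /hi; case: (ltgtP s t) => // ->; rewrite eqxx.
have hlohi : h lo = h hi.
  by rewrite /lo /hi; case: (leP s t); rewrite hs ht.
have [u ulh [dhu]] : exists2 u, u \in `]lo, hi[ & is_derive u 1 h 0.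
  apply: Rolle => //.
    move=> u; rewrite in_itv/= => /andP[lu uh].
    by have [] := dh u; rewrite ?(ltW lu) ?(ltW uh).
  apply/continuous_in_subspaceT => u; rewrite inE/= in_itv/= => /dh[dhu _].
  exact/differentiable_continuous/derivable1_diffP.
rewrite in_itv/= in ulh; case/andP: ulh => lu uh.
have us : u != s.
  move: lu uh; rewrite /lo /hi; case: (leP s t) => _ lu uh.
    by rewrite gt_eqF.
  by rewrite lt_eqF.
have ulh : Num.min s t <= u <= Num.max s t by rewrite (ltW lu) (ltW uh).
have [_ ->] := dh u ulh.
move=> /eqP; rewrite subr_eq0 => /eqP /(congr1 Num.norm).
rewrite !normrM !normrX normr_nat => E.
have us0 : 0 < `|u - s| ^+ n by rewrite exprn_gt0// normr_gt0 subr_eq0.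
rewrite ler_pdivlMr ?ltr0n// -(ler_pM2r us0) -mulrA -E mulrAC.
by rewrite ler_wpM2r ?exprn_ge0// f'c.
Qed.

(** The function expR u - 1 - u - u^2 / 2 has derivative expR u - 1 - u, which is at most 2 u^2 in
    absolute value for |u| <= 1/2, because 1 + u <= expR u <= 1 / (1 - u). Integration by
    [growth_bound] gives 2 |y|^3 / 3, which is below the cubic term |y|^3 of the claim. *)
Lemma expR_le_quad (y : R) : `|y| <= 2^-1 ->
  expR y <= 1 + y + y ^+ 2 / 2 * (1 + 2 * `|y|).
Proof.
move=> y2.
have e1 u : `|u| <= 2^-1 :> R -> `|expR u - 1 - u| <= 2 * u ^+ 2.
  rewrite ler_norml => /andP[u1 u2].
  have ge : 1 + u <= expR u by exact: expR_ge1Dx.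
  rewrite ger0_norm; last by lra.
  have := expR_ge1Dx (- u); rewrite expRN => le.
  have u0 : 0 < 1 - u by lra.
  have {le}: expR u <= (1 - u)^-1.
    by rewrite -[expR u]invrK lef_pV2 ?posrE ?invr_gt0 ?expR_gt0.
  have : (1 - u)^-1 <= 1 + u + 2 * u ^+ 2.
    by rewrite -[leLHS]mul1r ler_pdivrMr//; nra.
  by lra.
pose f u : R := expR u - 1 - u - u ^+ 2 / 2.
have df (u : R) : is_derive u 1 f (expR u - 1 - u).
  have d1 := is_derive_expR u; have d2 := is_derive_shiftX 1 0 u.
  have d3 := is_deriveB (is_deriveB d1 (is_derive_cst (1 : R) u 1)) (is_derive_id u (1 : R)).
  have := is_deriveB d3 (is_deriveZ (2^-1 : R) d2).
  have -> : expR - cst 1 - id - (2^-1 : R) \*: (fun u : R => (u - 0) ^+ 2) = f.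
    apply/funext => z; rewrite /f !fctE /cst /GRing.scale /= subr0.
    by rewrite mulrC.
  by move/is_derive_eq; apply; rewrite subr0 /GRing.scale /=; lra.
have f0 : f 0 = 0 by rewrite /f expR0; lra.
have := @growth_bound f 0 y 2 2 _ f0 _.
have bd u : Num.min 0 y <= u <= Num.max 0 y -> `|u| <= 2^-1.
  move: y2; rewrite !ler_norml; case: (leP 0 y) => _; lra.
have h1 : forall u, Num.min 0 y <= u <= Num.max 0 y -> derivable f u 1.
  by move=> u _; have [] := df u.
have h2 u : Num.min 0 y <= u <= Num.max 0 y ->
    `|derive1 f u| <= 2 * `|u - 0| ^+ 2.
  move=> /bd ub; rewrite derive1E; have [_ ->] := df u.
  by rewrite subr0 real_normK ?num_real// e1.
move=> /(_ h1 h2); rewrite subr0 => fy.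
have : f y <= 2 * `|y| ^+ 3 / 3%:R by apply: le_trans fy; exact: ler_norm.
have -> : `|y| ^+ 3 = y ^+ 2 * `|y| by rewrite exprSr real_normK ?num_real.
have := mulr_ge0 (sqr_ge0 y) (normr_ge0 y).
by rewrite /f; nra.
Qed.

(** For |y| <= 1/2 the quadratic bound applies; otherwise |y| <= 2 y^2. The exponent 2 y^2 in place
    of y^2 / 2 costs a factor 2 in [rademacher_max], which together with the 4 of [mean_supn_fcent]
    makes the 8 in A. *)
Lemma cosh_le (y : R) : (expR y + expR (- y)) / 2 <= expR (2 * y ^+ 2).
Proof.
have [y2|y2] := leP `|y| 2^-1.
  have h1 := expR_le_quad y2.
  have := @expR_le_quad (- y); rewrite normrN sqrrN => /(_ y2) h2.
  have := expR_ge1Dx (2 * y ^+ 2).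
  have : y ^+ 2 * `|y| <= y ^+ 2 * 2^-1 by rewrite ler_wpM2l ?sqr_ge0.
  have := sqr_ge0 y; nra.
have yy : `|y| <= 2 * y ^+ 2 by rewrite -(real_normK (num_real y)); nra.
have : expR y <= expR (2 * y ^+ 2).
  by rewrite ler_expR (le_trans _ yy)// ler_norm.
have : expR (- y) <= expR (2 * y ^+ 2).
  by rewrite ler_expR (le_trans _ yy)// -normrN ler_norm.
by lra.
Qed.

(* The constant [u0] need not be the mean of [U]; centering is absorbed by
   [1 + z <= expR z], and the variance proxy is the second moment of [U - u0]. *)
Lemma bernstein_step (B : finType) (p U beta : B -> R) (u0 b l : R) :
  pmf p -> (forall a, `|U a - u0| <= beta a) -> (forall a, beta a <= b) ->
  0 <= l -> l * b <= 2^-1 ->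
  \sum_a p a * expR (l * U a) <=
  expR (l * (\sum_a p a * U a) +
        l ^+ 2 / 2 * (1 + 2 * (l * b)) * \sum_a p a * beta a ^+ 2).
Proof.
move=> [p0 p1] Ub bb l0 lb; set Q := _ * (\sum_a p a * beta a ^+ 2).
apply: (@le_trans _ _ (expR (l * u0) * (1 + l * (\sum_a p a * (U a - u0)) + Q))).
  rewrite {}/Q; set K := l ^+ 2 / 2 * _.
  have -> : 1 + l * (\sum_a p a * (U a - u0)) + K * (\sum_a p a * beta a ^+ 2) =
      \sum_a p a * (1 + l * (U a - u0) + K * beta a ^+ 2).
    rewrite -[X in X + _ + _ = _]p1 !big_distrr -!big_split /=; apply: eq_bigr => a _; ring.
  rewrite big_distrr /=; apply: ler_sum => a _.
  have -> : l * U a = l * u0 + l * (U a - u0) by rewrite -mulrDr addrCA subrr addr0.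
  rewrite expRD mulrCA ler_wpM2l ?expR_ge0// ler_wpM2l//.
  have y2 : `|l * (U a - u0)| <= 2^-1.
    rewrite normrM (ger0_norm l0) (le_trans _ lb)// ler_wpM2l//.
    exact: le_trans (Ub a) (bb a).
  have := expR_le_quad y2; set y := _ * _ => hy.
  have b0 : 0 <= beta a by apply: le_trans (Ub a).
  have yb : y ^+ 2 <= l ^+ 2 * beta a ^+ 2.
    rewrite -exprMn -(real_normK (num_real y)) lerXn2r ?nnegrE ?mulr_ge0//.
    by rewrite /y normrM (ger0_norm l0) ler_wpM2l.
  have yl : `|y| <= l * b.
    rewrite /y normrM (ger0_norm l0) ler_wpM2l//; exact: le_trans (Ub a) (bb a).
  apply: le_trans hy _; rewrite lerD2l.
  have -> : K * beta a ^+ 2 = (l ^+ 2 * beta a ^+ 2) / 2 * (1 + 2 * (l * b)).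
    by rewrite /K; ring.
  apply: ler_pM; [|by have := normr_ge0 y; lra| |lra].
    by rewrite divr_ge0 ?sqr_ge0.
  by rewrite ler_pM2r ?invr_gt0.
have -> : \sum_a p a * U a = u0 + \sum_a p a * (U a - u0).
  under [in RHS]eq_bigr do rewrite mulrBr.
  by rewrite sumrB -big_distrl /= p1 mul1r addrCA subrr addr0.
rewrite [l * (u0 + _)]mulrDr -[l * u0 + _ + _]addrA expRD ler_wpM2l ?expR_ge0//.
by rewrite -addrA; exact: expR_ge1Dx.
Qed.

End scalar_bounds.

Section rademacher_maximum.
Variables (R : realType) (n p : nat).
Hypothesis p_gt0 : (0 < p)%N.

Let half : nat -> bool -> R := fun _ _ => 2^-1.

Let half_pmf k : pmf (half k).
Proof. by split=> [b|]; rewrite ?big_bool /half /= ?invr_ge0//; lra. Qed.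

(** Jensen's inequality for the exponential, from its tangent line at the mean c: expR F >= expR c *
    (1 + F - c). *)
Lemma expR_prodmean_half (F : {ffun 'I_n -> bool} -> R) :
  expR (prodmean half F) <= prodmean half (fun e => expR (F e)).
Proof.
set c := prodmean half F.
apply: (@le_trans _ _ (prodmean half (fun e => expR c * (1 + (F e - c))))); last first.
  apply: le_prodmean => // e.
  have -> : expR (F e) = expR c * expR (F e - c) by rewrite -expRD addrCA subrr addr0.
  by rewrite ler_wpM2l ?expR_ge0// expR_ge1Dx.
have -> : prodmean half (fun e => expR c * (1 + (F e - c))) =
   expR c * (prodmean half (fun _ : {ffun 'I_n -> bool} => 1 - c) + prodmean half F).
  rewrite /prodmean -big_split /= big_distrr /=; apply: eq_bigr => e _; ring.
by rewrite prodmean_const// -/c subrK mulr1.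
Qed.

Lemma rademacher_mgf (c : 'I_n -> R) :
  prodmean half (fun e => expR (\sum_i (-1) ^+ e i * c i)) <=
  expR (2 * \sum_i c i ^+ 2).
Proof.
have -> : prodmean half (fun e => expR (\sum_i (-1) ^+ e i * c i)) =
    \sum_(e : {ffun 'I_n -> bool}) \prod_i (2^-1 * expR ((-1) ^+ e i * c i)).
  by apply: eq_bigr => e _; rewrite expR_sum -big_split.
rewrite -(bigA_distr_bigA (fun i (e : bool) => 2^-1 * expR ((-1) ^+ e * c i))) /=.
rewrite mulr_sumr expR_sum; apply: ler_prod => i _.
rewrite big_bool /= expr1 expr0 mulN1r mul1r -mulrDr mulrC addrC.
by rewrite cosh_le mulr_ge0// addr_ge0 ?expR_ge0.
Qed.

(** By Jensen, expR (l * mean) is at most the mean of the exponential of l times the maximum. That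
    exponential is bounded by the sum over the 2 p signed linear forms, each with moment at most
    expR (2 l^2 v); then l is optimized. *)
Lemma rademacher_max (c : 'I_n -> 'I_p -> R) :
  prodmean half (fun e : {ffun 'I_n -> bool} =>
     \big[Num.max/0]_(j < p) `|\sum_i (-1) ^+ e i * c i j|) <=
  2 * Num.sqrt (2 * ln (2 * p%:R)) *
  Num.sqrt (\big[Num.max/0]_(j < p) \sum_i c i j ^+ 2).
Proof.
set M := fun e : {ffun 'I_n -> bool} => _.
set v := \big[Num.max/0]_(j < p) _; set s := Num.sqrt v.
have v0 : 0 <= v by exact: bigmax_ge_id.
have sv : s ^+ 2 = v by rewrite sqr_sqrtr.
have cv j : \sum_i c i j ^+ 2 <= v.
  exact: (le_bigmax _ (fun j => \sum_i c i j ^+ 2)).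
set k := ln _.
have p1 : 1 <= p%:R :> R by rewrite ler1n.
have k0 : 0 < k by rewrite ln_gt0//; lra.
(* If s = 0 all coefficients vanish; this case is separate because the optimal l divides by s. *)
have [s0|s0] := eqVneq s 0.
  rewrite s0 mulr0 le_eqVlt; apply/orP; left; apply/eqP.
  have c0 i j : c i j = 0.
    apply/eqP; rewrite -sqrf_eq0 eq_le sqr_ge0 andbT.
    rewrite (le_trans _ (le_trans (cv j) _)) -?sv ?s0 ?expr0n//.
    by rewrite (bigD1 i)//= lerDl; apply: sumr_ge0 => ? _; exact: sqr_ge0.
  rewrite /prodmean big1// => e _; rewrite /M.
  suff -> : \big[Num.max/0]_(j < p) `|\sum_i (-1) ^+ e i * c i j| = 0 by rewrite mulr0.
  apply: (big_ind (fun m => m = 0)) => // [_ _ -> ->|j _]; first by rewrite maxxx.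
  by rewrite big1 ?normr0// => i _; rewrite c0 mulr0.
have {}s0 : 0 < s by rewrite lt_def s0 sqrtr_ge0.
set r := Num.sqrt (2 * k).
have r0 : 0 < r by rewrite sqrtr_gt0 mulr_gt0.
have rr : r ^+ 2 = 2 * k by rewrite sqr_sqrtr ?mulr_ge0 ?ltW.
(* This l minimizes (k + 2 l^2 s^2) / l: both terms of the numerator equal r^2 / 2, and the quotient
   is 2 r s. *)
pose l := r / (2 * s).
have l0 : 0 < l by rewrite divr_gt0// mulr_gt0.
have key : expR (l * prodmean half M) <= expR (k + 2 * (l ^+ 2 * v)).
  have -> : l * prodmean half M = prodmean half (fun e => l * M e).
    by rewrite /prodmean big_distrr /=; apply: eq_bigr => e _; rewrite mulrCA.
  apply: le_trans (expR_prodmean_half _) _.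
  pose S j (e : {ffun 'I_n -> bool}) : R := \sum_i (-1) ^+ e i * (l * c i j).
  pose S' j (e : {ffun 'I_n -> bool}) : R := \sum_i (-1) ^+ e i * (- (l * c i j)).
  apply: (@le_trans _ _ (\sum_(j < p) (prodmean half (fun e => expR (S j e)) +
      prodmean half (fun e => expR (S' j e))))).
    rewrite /prodmean; under [leRHS]eq_bigr do rewrite -big_split /=.
    rewrite exchange_big /=; apply: ler_sum => e _.
    under [leRHS]eq_bigr do rewrite -mulrDr.
    rewrite -big_distrr /= ler_wpM2l//.
      by apply: prodr_ge0 => i _; exact: (half_pmf i).1.
    have SE j : S j e = l * \sum_i (-1) ^+ e i * c i j.
      by rewrite /S big_distrr /=; apply: eq_bigr => i _; rewrite mulrCA.
    have S'E j : S' j e = - S j e.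
      by rewrite /S' /S -sumrN; apply: eq_bigr => i _; rewrite mulrN.
    have nn j : 0 <= expR (S j e) + expR (S' j e) by rewrite addr_ge0 ?expR_ge0.
    have le_j j : expR (`|S j e|) <= expR (S j e) + expR (S' j e).
      rewrite S'E; case: (ger0P (S j e)) => h.
        by rewrite lerDl expR_ge0.
      by rewrite lerDr expR_ge0.
    have le_sum j : expR (S j e) + expR (S' j e) <= \sum_j (expR (S j e) + expR (S' j e)).
      by rewrite (bigD1 j)//= lerDl sumr_ge0.
    (* If the maximum is the default 0, any index j serves, and one exists since p > 0. *)
    case: (bigmax_attained (fun j => `|\sum_i (-1) ^+ e i * c i j|)) => [E|[j E]].
      rewrite /M E mulr0; apply: le_trans (le_sum (Ordinal p_gt0)).
      apply: le_trans (le_j _); rewrite ler_expR//.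
    rewrite /M E; apply: le_trans (le_sum j); apply: le_trans (le_j j).
    by rewrite SE normrM (gtr0_norm l0).
  apply: (@le_trans _ _ (\sum_(j < p) 2 * expR (2 * (l ^+ 2 * v)))).
    apply: ler_sum => j _; rewrite mulr_natl mulr2n.
    have le_v : 2 * (\sum_i (l * c i j) ^+ 2) <= 2 * (l ^+ 2 * v).
      rewrite ler_pM2l//; under eq_bigr do rewrite exprMn.
      by rewrite -big_distrr /= ler_wpM2l ?sqr_ge0.
    apply: lerD; apply: le_trans (rademacher_mgf _) _; rewrite ler_expR//.
    by under eq_bigr do rewrite sqrrN.
  rewrite sumr_const card_ord -[_ *+ p]mulr_natl expRD /k lnK ?posrE; last by lra.
  by rewrite mulrCA -[2 * p%:R * _]mulrA.
move: key; rewrite ler_expR => key.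
have lsr : l * (2 * s) = r by rewrite /l divfK// mulf_neq0// gt_eqF.
have : l * prodmean half M <= l * (2 * r * s).
  apply: le_trans key _; rewrite -sv.
  have -> : l * (2 * r * s) = (l * (2 * s)) * r by ring.
  have -> : 2 * (l ^+ 2 * s ^+ 2) = (l * (2 * s)) ^+ 2 / 2 by field.
  by rewrite lsr -expr2; lra.
by rewrite ler_pM2l.
Qed.

End rademacher_maximum.

(** * Concentration for finitely valued variables *)

Section finite_tail.
Variables (R : realType) (A V : finType) (p n : nat).
Variables (q : nat -> A -> R) (q_pmf : forall k, pmf (q k)).
Variables (f : nat -> A -> {ffun V -> R}) (eta : nat -> A -> 'I_p -> R).
Variables (u : V -> 'I_p -> R) (wt : nat -> A -> R) (L D phi : R).
Hypotheses (p_gt0 : (0 < p)%N) (L_ge0 : 0 <= L) (D_ge0 : 0 <= D) (phi_ge0 : 0 <= phi).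
Hypothesis f_dom : forall k a,
  dominated (f k a) [ffun v => L * \sum_(j < p) eta k a j * u v j].
Hypothesis f_wt : forall k a v, `|f k a v| <= phi * `|wt k a|.
Hypothesis wt_le1 : forall k a, `|wt k a| <= 1.
Hypothesis u_le : forall v, \sum_(j < p) `|u v j| <= D.

Let maxsq (s : {ffun 'I_n -> A}) : R :=
  \big[Num.max/0]_(j < p) \sum_(i < n) eta i (s i) j ^+ 2.

(** After contraction the signed sum is linear in [u v], so duality between the l1 and sup norms
    separates v, which contributes at most D, from the Rademacher averages of the columns of
    [eta]. *)
Lemma mean_supn_bound :
  itmean q (fcent q f) n (@supn R V) 0 <=
  8 * L * D * Num.sqrt (2 * ln (2 * p%:R)) * prodmean q (fun s => Num.sqrt (maxsq s)).
Proof.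
apply: le_trans (mean_supn_fcent q_pmf n f_dom) _.
rewrite itmeanE prodmean_sign.
set c := Num.sqrt (2 * _).
have -> : 8 * L * D * c * prodmean q (fun s => Num.sqrt (maxsq s)) =
    4 * prodmean q (fun s : {ffun 'I_n -> A} => L * D * (2 * c * Num.sqrt (maxsq s))).
  rewrite /prodmean !big_distrr /=; apply: eq_bigr => s _; ring.
rewrite ler_wpM2l//; apply: le_prodmean => // s.
apply: le_trans (ler_wpM2l _ (rademacher_max p_gt0 (fun i => eta i (s i)))); last first.
  exact: mulr_ge0.
rewrite /prodmean big_distrr /=; apply: ler_sum => e _; rewrite mulrCA.
rewrite ler_wpM2l//; first by apply: prodr_ge0 => i _; rewrite invr_ge0.
set M := \big[_/_]_(j < p) _.
have M0 : 0 <= M by exact: bigmax_ge_id.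
apply: supn_le => [|v]; first by rewrite !mulr_ge0.
have -> : (0 + \sum_(i < n) fsign (fun k a => [ffun v => L * \sum_(j < p) eta k a j * u v j])
     i ([ffun i => (s i, e i)] i)) v =
   L * \sum_(j < p) (\sum_i (-1) ^+ e i * eta i (s i) j) * u v j.
  rewrite add0r sum_ffunE; under eq_bigr do rewrite !ffunE /= /GRing.scale /= mulrCA.
  rewrite -big_distrr /=; congr (_ * _).
  under eq_bigr do rewrite big_distrr /=.
  rewrite exchange_big /=; apply: eq_bigr => j _; rewrite big_distrl /=.
  by apply: eq_bigr => i _; rewrite mulrA.
rewrite normrM (ger0_norm L_ge0) -mulrA ler_wpM2l//.
apply: le_trans (ler_wpM2r M0 (u_le v)).
apply: le_trans (ler_norm_sum _ _ _) _; rewrite big_distrl /=.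
apply: ler_sum => j _; rewrite normrM mulrC ler_wpM2l//.
exact: (le_bigmax _ (fun j => `|\sum_i (-1) ^+ e i * eta i (s i) j|)).
Qed.

Let var : R := \sum_(i < n) \sum_a q i a * wt i a ^+ 2.

(* Martingale argument: integrating out one variable at a time, the conditional mean [H] of
   the sup norm is 1-Lipschitz, so [H (x + f a - E f)] stays within [phi * `|wt a|] of
   [H (x - E f)]. *)
Lemma itmean_expR l x : 0 <= l -> l * phi <= 2^-1 ->
  itmean q (fcent q f) n (fun y => expR (l * supn y)) x <=
  expR (l * itmean q (fcent q f) n (@supn R V) x +
        l ^+ 2 / 2 * (1 + 2 * (l * phi)) * (phi ^+ 2 * var)).
Proof.
move=> l0 lphi; rewrite {}/var; elim: n x => [|k IH] x /=.
  by rewrite big_ord0 !mulr0 addr0.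
set K := l ^+ 2 / 2 * _.
pose H y := itmean q (fcent q f) k (@supn R V) y.
have HL : lip1 H by apply: itmean_lip1 => //; exact: supn_lip.
apply: (@le_trans _ _ (\sum_a q k a * (expR (l * H (x + fcent q f k a)) *
    expR (K * (phi ^+ 2 * \sum_(i < k) \sum_a q i a * wt i a ^+ 2))))).
  by apply: wsum_le => // a; rewrite -expRD; exact: IH.
rewrite big_ord_recr /=; set S := \sum_(i < k) _.
have -> : l * (\sum_a q k a * H (x + fcent q f k a)) +
    K * (phi ^+ 2 * (S + \sum_a q k a * wt k a ^+ 2)) =
    (l * (\sum_a q k a * H (x + fcent q f k a)) +
     K * \sum_a q k a * (phi * `|wt k a|) ^+ 2) + K * (phi ^+ 2 * S).
  have -> : \sum_a q k a * (phi * `|wt k a|) ^+ 2 =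
      phi ^+ 2 * \sum_a q k a * wt k a ^+ 2.
    rewrite big_distrr /=; apply: eq_bigr => a _.
    by rewrite exprMn real_normK ?num_real// mulrCA.
  ring.
rewrite expRD (eq_bigr (fun a => q k a * expR (l * H (x + fcent q f k a)) *
  expR (K * (phi ^+ 2 * S)))); last by move=> a _; rewrite mulrA.
rewrite -big_distrl /= ler_wpM2r ?expR_ge0//.
apply: (bernstein_step (u0 := H (x - fmean q f k))) => // a.
- apply: le_trans (HL _ _) _.
  have -> : x + fcent q f k a - (x - fmean q f k) = f k a.
    by rewrite /fcent opprB addrCA -addrA addrC [x + _]addrC subrK subrK.
  by apply: supn_le => //; rewrite mulr_ge0.
- by rewrite -[leRHS]mulr1 ler_wpM2l.
Qed.

(** Markov's inequality for expR (l * supn), with the moment bound of [itmean_expR] and the mean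
    bound of [mean_supn_bound]. *)
Lemma finite_tail (x : R) : 0 < x ->
  prodmean q (fun s : {ffun 'I_n -> A} =>
    (8 * L * D * Num.sqrt (2 * ln (2 * p%:R)) * prodmean q (fun s => Num.sqrt (maxsq s))
     + phi * Num.sqrt var * Num.sqrt (2 * x) + 8 * phi * x
     < supn (\sum_(i < n) fcent q f i (s i)))%R%:R) <= expR (- x).
Proof.
move=> x0; set EB := 8 * L * D * _ * _; set sg := phi * Num.sqrt var.
set w := Num.sqrt (2 * x); set T := EB + _ + _.
have EB0 : 0 <= EB.
  rewrite /EB !mulr_ge0 ?sqrtr_ge0//; apply: sumr_ge0 => s _.
  by rewrite mulr_ge0 ?sqrtr_ge0//; apply: prodr_ge0 => i _; exact: (q_pmf i).1.
have w0 : 0 < w by rewrite sqrtr_gt0 mulr_gt0.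
have ww : w ^+ 2 = 2 * x by rewrite sqr_sqrtr// mulr_ge0// ltW.
have sg0 : 0 <= sg by rewrite mulr_ge0 ?sqrtr_ge0.
have var0 : 0 <= var.
  by apply: sumr_ge0 => i _; apply: sumr_ge0 => a _; rewrite mulr_ge0 ?sqr_ge0 ?(q_pmf i).1.
have T0 : 0 <= T by rewrite !addr_ge0// !mulr_ge0// ltW.
(* For phi = 0 the denominator of l below would vanish, but then every f is 0 and the event is
   empty. *)
have [phi00|phin0] := eqVneq phi 0.
  have f0 k a : f k a = 0.
    apply/ffunP => v; rewrite ffunE; apply/eqP; rewrite -normr_le0.
    by rewrite (le_trans (f_wt _ _ _))// phi00 mul0r.
  rewrite [leLHS](_ : _ = 0) ?expR_ge0// /prodmean big1// => s _.
  suff -> : supn (\sum_(i < n) fcent q f i (s i)) = 0 by rewrite ltNge T0 mulr0.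
  rewrite big1 => [|i _]; last first.
    by rewrite /fcent /fmean f0 big1 ?subr0// => a _; rewrite f0 scaler0.
  apply/eqP; rewrite eq_le supn_ge0 andbT; apply: supn_le => // v.
  by rewrite ffunE normr0.
have phi0 : 0 < phi by rewrite lt_def phin0.
(* The Gaussian optimum would be w / sg. The extra term forces l * phi <= 1/2, the range required by
   [bernstein_step], and gives l * sg = w * (1 - 2 * (l * phi)). With c = l * phi the final exponent
   is then at most - x - 2 c x. *)
pose den := sg + 2 * phi * w; pose l := w / den.
have den0 : 0 < den by rewrite ltr_wpDl// !mulr_gt0.
have l0 : 0 < l by rewrite divr_gt0.
have lden : l * sg + 2 * (l * phi) * w = w.
  have : l * den = w by rewrite /l divfK// gt_eqF.
  by rewrite /den; lra.
have lphi : l * phi <= 2^-1.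
  have : 0 <= l * sg by rewrite mulr_ge0// ltW.
  by nra.
apply: (@le_trans _ _ (prodmean q (fun s : {ffun 'I_n -> A} =>
    expR (- (l * T)) * expR (l * supn (0 + \sum_(i < n) fcent q f i (s i)))))).
  apply: le_prodmean => // s; rewrite add0r -expRD.
  set Z := supn _; case: (ltP T Z) => [TZ|_]; last by rewrite expR_ge0.
  by rewrite -expR0 ler_expR addrC -mulrBr mulr_ge0 ?subr_ge0 ?ltW.
have -> : prodmean q (fun s : {ffun 'I_n -> A} => expR (- (l * T)) *
      expR (l * supn (0 + \sum_(i < n) fcent q f i (s i)))) =
    expR (- (l * T)) * itmean q (fcent q f) n (fun y => expR (l * supn y)) 0.
  rewrite itmeanE /prodmean big_distrr /=; apply: eq_bigr => s _; exact: mulrCA.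
apply: le_trans (ler_wpM2l (expR_ge0 _) (itmean_expR 0 (ltW l0) lphi)) _.
rewrite -expRD ler_expR.
have -> : phi ^+ 2 * var = sg ^+ 2 by rewrite exprMn sqr_sqrtr.
have := ler_wpM2l (ltW l0) mean_supn_bound; rewrite -/EB.
set m := itmean _ _ _ _ _ => lm.
pose c := l * phi; pose a := l * sg.
have -> : l ^+ 2 / 2 * (1 + 2 * (l * phi)) * sg ^+ 2 = a ^+ 2 / 2 * (1 + 2 * c).
  by rewrite /a /c; ring.
have -> : l * T = l * EB + a * w + 4 * c * (2 * x).
  by rewrite /T /a /c; ring.
have aE : a = w * (1 - 2 * c) by rewrite /a /c; lra.
have c0 : 0 <= c by rewrite mulr_ge0 ?ltW.
have {lden} -> : a * w = 2 * x * (1 - 2 * c) by rewrite aE -ww; ring.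
have -> : a ^+ 2 = 2 * x * (1 - 2 * c) ^+ 2 by rewrite aE exprMn ww.
have c2 : c <= 2^-1 by [].
have : (1 - 2 * c) ^+ 2 <= 1 by rewrite expr_le1//; lra.
have : 0 <= (1 - 2 * c) ^+ 2 by exact: sqr_ge0.
set d := (1 - 2 * c) ^+ 2 => d0 d1.
have : 0 <= x * (1 - d) * (1 + 2 * c).
  by rewrite mulr_ge0 ?mulr_ge0//; try lra; exact: ltW.
have : 0 <= x * c by rewrite mulr_ge0// ltW.
by nra.
Qed.

End finite_tail.

(** * Taylor remainders *)

Section taylor_remainder.
Variable R : realType.
Implicit Types (g : R -> R) (I : R -> Prop) (s t u : R) (m : nat).

Definition taylor_rem g m s t : R :=
  g t - \sum_(k < m.+1) k`!%:R^-1 * (derive1n k g s * (t - s) ^+ k).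

(* When [m > 0], the convention [x / 0 = 0] makes this vanish at [t = s], the value
   that extends it continuously. *)
Definition taylor_quot g m s t : R := taylor_rem g m s t / (t - s) ^+ m.

Definition interval_set I := forall s t u, I s -> I t ->
  Num.min s t <= u <= Num.max s t -> I u.

Definition smooth_on I g m := forall k, (k < m)%N -> forall t, I t ->
  derivable (derive1n k g) t 1.

Definition lipschitz_on I (G : R) g := forall t u, I t -> I u ->
  `|g t - g u| <= G * `|t - u|.

Lemma derive1n_derive1 k g : derive1n k (derive1 g) = derive1n k.+1 g.
Proof. by rewrite /derive1n -iterSr. Qed.

Lemma smooth_on_derive1 I g m : smooth_on I g m.+1 -> smooth_on I (derive1 g) m.
Proof. by move=> gs k km t It; rewrite derive1n_derive1; exact: gs. Qed.

Lemma taylor_rem0 g s t : taylor_rem g 0 s t = g t - g s.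
Proof. by rewrite /taylor_rem big_ord1 fact0 invr1 mul1r expr0 mulr1. Qed.

Lemma taylor_rem_id g m s : taylor_rem g m s s = 0.
Proof.
rewrite /taylor_rem big_ord_recl fact0 invr1 mul1r expr0 mulr1 derive1n0.
rewrite big1 => [|k _]; first by rewrite addr0 subrr.
by rewrite subrr expr0n /= !mulr0.
Qed.

(** Differentiation in t turns the remainder of g into that of its derivative, of one order less.
    The inductions on m below integrate this back with [growth_bound]. *)
Lemma is_derive_taylor_rem g m s t : derivable g t 1 ->
  is_derive t 1 (taylor_rem g m.+1 s) (taylor_rem (derive1 g) m s t).
Proof.
move=> dg.
have d0 : is_derive t 1 g (derive1 g t) by rewrite derive1E; exact/derivableP.
pose h (k : 'I_m.+1) u := k.+1`!%:R^-1 * derive1n k.+1 g s * (u - s) ^+ k.+1.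
have dh k : is_derive t 1 (h k) (k`!%:R^-1 * (derive1n k (derive1 g) s * (t - s) ^+ k)).
  have := is_deriveZ (k.+1`!%:R^-1 * derive1n k.+1 g s) (is_derive_shiftX k s t).
  move/is_derive_eq; apply; rewrite derive1n_derive1 /GRing.scale /= factS natrM invfM.
  have k0 : k.+1%:R != 0 :> R by rewrite pnatr_eq0.
  have f0 : k`!%:R != 0 :> R by rewrite pnatr_eq0 -lt0n fact_gt0.
  by field; rewrite f0 nat1r k0.
have := is_deriveB (is_deriveB d0 (is_derive_cst (g s) t (1 : R)))
  (is_derive_sum dh).
have -> : g - cst (g s) - \sum_i h i = taylor_rem g m.+1 s.
  apply/funext => u; rewrite /taylor_rem [in RHS]big_ord_recl fact0 invr1 mul1r expr0 mulr1.
  rewrite derive1n0 opprD addrA !fctE /cst fct_sumE; congr (_ - _ - _).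
  by apply: eq_bigr => k _; rewrite /h mulrA.
by rewrite subr0.
Qed.

Section bounds.
Variables (I : R -> Prop) (F G : R).
Hypothesis I_interval : interval_set I.

(** The factor 2 comes from order 0, where the remainder g t - g s is bounded by 2 F; every later
    order only contributes a factor of the factorial. *)
Lemma taylor_rem_le g m s t : smooth_on I g m ->
  (forall u, I u -> `|derive1n m g u| <= F) -> I s -> I t ->
  `|taylor_rem g m s t| <= 2 * F / m`!%:R * `|t - s| ^+ m.
Proof.
elim: m g t => [|m IH] g t gs gF Is It.
  rewrite taylor_rem0 fact0 divr1 expr0 mulr1 mulr2n mulrDl mul1r.
  by rewrite (le_trans (ler_normB _ _))// lerD//; exact: gF.
have d u : I u -> is_derive u 1 (taylor_rem g m.+1 s) (taylor_rem (derive1 g) m s u).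
  by move=> Iu; apply: is_derive_taylor_rem; exact: (gs 0%N).
have := @growth_bound _ (taylor_rem g m.+1 s) s t (2 * F / m`!%:R) m.
have -> : 2 * F / m`!%:R * `|t - s| ^+ m.+1 / m.+1%:R =
    2 * F / m.+1`!%:R * `|t - s| ^+ m.+1.
  by rewrite factS natrM invfM; ring.
apply.
- by move=> u su; have [] := d u (I_interval Is It su).
- exact: taylor_rem_id.
- move=> u su; rewrite derive1E; have [_ ->] := d u (I_interval Is It su).
  apply: IH => //; first exact: smooth_on_derive1.
  + by move=> v Iv; rewrite derive1n_derive1; exact: gF.
  + exact: I_interval Is It su.
Qed.

Lemma taylor_rem_leS g m s t : smooth_on I g m ->
  lipschitz_on I G (derive1n m g) -> I s -> I t ->
  `|taylor_rem g m s t| <= G / m.+1`!%:R * `|t - s| ^+ m.+1.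
Proof.
elim: m g t => [|m IH] g t gs gG Is It.
  by rewrite taylor_rem0 divr1 expr1; exact: gG.
have d u : I u -> is_derive u 1 (taylor_rem g m.+1 s) (taylor_rem (derive1 g) m s u).
  by move=> Iu; apply: is_derive_taylor_rem; exact: (gs 0%N).
have := @growth_bound _ (taylor_rem g m.+1 s) s t (G / m.+1`!%:R) m.+1.
have -> : G / m.+1`!%:R * `|t - s| ^+ m.+2 / m.+2%:R =
    G / m.+2`!%:R * `|t - s| ^+ m.+2.
  by rewrite [m.+2`!]factS natrM invfM; ring.
apply.
- by move=> u su; have [] := d u (I_interval Is It su).
- exact: taylor_rem_id.
- move=> u su; rewrite derive1E; have [_ ->] := d u (I_interval Is It su).
  apply: IH => //; first exact: smooth_on_derive1.
  + by rewrite derive1n_derive1.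
  + exact: I_interval Is It su.
Qed.

Let quot_num g m s t : R :=
  taylor_rem (derive1 g) m s t * (t - s) - m.+1%:R * taylor_rem g m.+1 s t.

(* [quot_num g m s t / (t - s)^(m + 2)] is the derivative of [taylor_quot g m.+1 s] at
   [t]; the bound follows by induction since the derivative of [quot_num g m.+1 s] is
   [quot_num (derive1 g) m s]. *)
Lemma quot_num_le g m s t : smooth_on I g m.+1 ->
  lipschitz_on I G (derive1n m.+1 g) -> I s -> I t ->
  `|quot_num g m s t| <= G / m.+2`!%:R * `|t - s| ^+ m.+2.
Proof.
elim: m g t => [|m IH] g t gs gG Is It.
  (* For order 0 the numerator is the first-order remainder with the roles of s and t exchanged. *)
  have -> : quot_num g 0 s t = taylor_rem g 1 t s.
    rewrite /quot_num taylor_rem0 mul1r /taylor_rem !big_ord_recl !big_ord0 /=.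
    rewrite /bump /= !fact0 factS fact0 /derive1n /= muln1 !invr1 addn0; ring.
  by rewrite [`|t - s|]distrC; exact: taylor_rem_leS.
have d u : I u -> is_derive u 1 (quot_num g m.+1 s) (quot_num (derive1 g) m s u).
  move=> Iu.
  have d1 : is_derive u 1 (taylor_rem g m.+2 s) (taylor_rem (derive1 g) m.+1 s u).
    by apply: is_derive_taylor_rem; exact: (gs 0%N).
  have d2 : is_derive u 1 (taylor_rem (derive1 g) m.+1 s)
      (taylor_rem (derive1 (derive1 g)) m s u).
    by apply: is_derive_taylor_rem; exact: (gs 1%N).
  have d3 := is_derive_shiftX 0 s u.
  have := is_deriveB (is_deriveM d2 d3) (is_deriveZ m.+2%:R d1).
  move/is_derive_eq; apply.
  by rewrite /quot_num /GRing.scale /= expr1 expr0 -[m.+2%:R]natr1; ring.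
have := @growth_bound _ (quot_num g m.+1 s) s t (G / m.+2`!%:R) m.+2.
have -> : G / m.+2`!%:R * `|t - s| ^+ m.+3 / m.+3%:R =
    G / m.+3`!%:R * `|t - s| ^+ m.+3.
  by rewrite [m.+3`!]factS natrM invfM; ring.
apply.
- by move=> u su; have [] := d u (I_interval Is It su).
- by rewrite /quot_num !taylor_rem_id mul0r mulr0 subrr.
- move=> u su; rewrite derive1E; have [_ ->] := d u (I_interval Is It su).
  apply: IH => //; first exact: smooth_on_derive1.
  + by rewrite derive1n_derive1.
  + exact: I_interval Is It su.
Qed.

Lemma taylor_rem_quot g m s t : taylor_rem g m s t = taylor_quot g m s t * (t - s) ^+ m.
Proof.
rewrite /taylor_quot; have [->|ts] := eqVneq t s.
  by rewrite taylor_rem_id !mul0r.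
by rewrite divfK// expf_neq0// subr_eq0.
Qed.

Lemma taylor_quot_id g m s : taylor_quot g m s s = 0.
Proof. by rewrite /taylor_quot taylor_rem_id mul0r. Qed.

Lemma taylor_quot_le g m s t : smooth_on I g m ->
  (forall u, I u -> `|derive1n m g u| <= F) -> I s -> I t -> 0 <= F ->
  `|taylor_quot g m s t| <= 2 * F / m`!%:R.
Proof.
move=> gs gF Is It F0; have [->|ts] := eqVneq t s.
  by rewrite taylor_quot_id normr0 !mulr_ge0.
rewrite /taylor_quot normrM normfV normrX ler_pdivrMr ?exprn_gt0 ?normr_gt0 ?subr_eq0//.
exact: taylor_rem_le.
Qed.

Lemma taylor_quot_leS g m s t : smooth_on I g m ->
  lipschitz_on I G (derive1n m g) -> I s -> I t ->
  `|taylor_quot g m s t| <= G / m.+1`!%:R * `|t - s|.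
Proof.
move=> gs gG Is It; have [->|ts] := eqVneq t s.
  by rewrite taylor_quot_id subrr normr0 mulr0.
rewrite /taylor_quot normrM normfV normrX ler_pdivrMr ?exprn_gt0 ?normr_gt0 ?subr_eq0//.
by rewrite -[leRHS]mulrA -exprS; exact: taylor_rem_leS.
Qed.

(** If s separates t and u, then |t - s| + |u - s| = |t - u| and the bounds of [taylor_quot_leS] at
    t and u add up. Otherwise the segment from u to t avoids s, the quotient is differentiable
    there, and [quot_num_le] bounds its derivative by the Lipschitz constant. *)
Lemma taylor_quot_lip g m s t u : smooth_on I g m ->
  lipschitz_on I G (derive1n m g) -> I s -> I t -> I u ->
  `|taylor_quot g m s t - taylor_quot g m s u| <= G / m.+1`!%:R * `|t - u|.
Proof.
case: m => [|m] gs gG Is It Iu.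
  rewrite /taylor_quot !expr0 !divr1 !taylor_rem0 opprB addrA subrK.
  exact: gG.
set c := G / _.
have [same|opp] := ltP 0 ((t - s) * (u - s)); last first.
  apply: le_trans (ler_normB _ _) _.
  apply: le_trans (lerD (taylor_quot_leS gs gG Is It) (taylor_quot_leS gs gG Is Iu)) _.
  rewrite -/c -mulrDr le_eqVlt; apply/orP; left; apply/eqP; congr (_ * _).
  case: (ger0P (t - s)) => ts; case: (ger0P (u - s)) => us;
    case: (ger0P (t - u)) => tu; nra.
have dq v : Num.min u t <= v <= Num.max u t -> v != s /\
    is_derive v 1 (fun v => taylor_quot g m.+1 s v - taylor_quot g m.+1 s u)
      (quot_num g m s v / (v - s) ^+ m.+2).
  move=> vs; have Iv := I_interval Iu It vs.
  have vs0 : v - s != 0.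
    move: vs; case: (leP u t) => ut /andP[uv vt]; apply/negP => /eqP vs; nra.
  split; first by rewrite -subr_eq0.
  have d1 : is_derive v 1 (taylor_rem g m.+1 s) (taylor_rem (derive1 g) m s v).
    by apply: is_derive_taylor_rem; exact: (gs 0%N).
  have d2 := @is_deriveV _ (fun u => (u - s) ^+ m.+1) v _ 1 (expf_neq0 m.+1 vs0)
    (is_derive_shiftX m s v).
  have := is_deriveB (is_deriveM d1 d2)
    (is_derive_cst (taylor_quot g m.+1 s u) v (1 : R)).
  move/is_derive_eq; apply.
  rewrite /quot_num /GRing.scale /= subr0 !exprS.
  have vm : (v - s) ^+ m != 0 by rewrite expf_neq0.
  by field; rewrite vm vs0.
have := @growth_bound _ (fun v => taylor_quot g m.+1 s v - taylor_quot g m.+1 s u) u t c 0.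
rewrite expr1 divr1; apply.
- by move=> v /dq[_ []].
- by rewrite subrr.
- move=> v vs; have [v0 [_ D]] := dq v vs.
  rewrite derive1E D expr0 mulr1 normrM normfV normrX.
  rewrite ler_pdivrMr ?exprn_gt0 ?normr_gt0 ?subr_eq0//.
  exact: quot_num_le (I_interval Iu It vs).
Qed.

End bounds.
End taylor_remainder.

(** * Measurable versions of the derivatives *)

Section measurable_versions.
Variables (R : realType) (d : measure_display) (T : measurableType d).
Variable g : R -> T -> R.
Hypothesis g_meas : forall t, measurable_fun setT (g t).

Definition grid n (t : R) : R := (Num.floor (n.+1%:R * t))%:~R / n.+1%:R.

(* Iterated difference quotients along [1 / (n + 1)], with upper limits in place of
   limits, of a version of [g] that only reads its values on rational arguments. Where
   [g ^~ y] is smooth this is [derive1n k (g ^~ y)]; unlike the latter it is jointly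
   measurable. *)
Fixpoint difference_limit (k : nat) (z : R * T) : R :=
  match k with
  | 0 => fine (limn_esup (fun n => (g (grid n z.1) z.2)%:E))
  | k'.+1 => fine (limn_esup (fun n =>
      (n.+1%:R * (difference_limit k' (n.+1%:R^-1 + z.1, z.2) - difference_limit k' z))%:E))
  end.

Lemma difference_limitS k z : difference_limit k.+1 z = fine (limn_esup (fun n =>
  (n.+1%:R * (difference_limit k (n.+1%:R^-1 + z.1, z.2) - difference_limit k z))%:E)).
Proof. by []. Qed.

(** [grid n] takes countably many values, each on a half-open interval, so a preimage is a countable
    union of rectangles. *)
Lemma measurable_grid n : measurable_fun setT (fun z : R * T => g (grid n z.1) z.2).
Proof.
move=> _ B mB; rewrite setTI.
have -> : (fun z : R * T => g (grid n z.1) z.2) @^-1` B =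
    \bigcup_(k : int) (`[k%:~R / n.+1%:R, (k + 1)%:~R / n.+1%:R[%classic `*`
      (g (k%:~R / n.+1%:R) @^-1` B)).
  have kE (k : int) (t : R) : (`[k%:~R / n.+1%:R, (k + 1)%:~R / n.+1%:R[%classic t) <->
      Num.floor (n.+1%:R * t) = k.
    rewrite /= in_itv /= ler_pdivrMr// ltr_pdivlMr// mulrC -floor_eq.
    by split=> [/eqP|->].
  apply/seteqP; split=> [[t y] /= By|[t y] [k _] [/= /kE <-]]; last by [].
  exists (Num.floor (n.+1%:R * t)) => //; split=> //=; exact/kE.
apply: countable_bigcupT_measurable => [|k]; first exact: countableP.
apply: measurableX; first exact: measurable_itv.
by rewrite -[X in measurable X]setTI; exact: g_meas.
Qed.

Lemma measurable_difference_limit k : measurable_fun setT (difference_limit k).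
Proof.
elim: k => [|k IH].
  pose F (z : R * T) : \bar R := limn_esup (fun n => (g (grid n z.1) z.2)%:E).
  suff m0 : measurable_fun setT F.
    exact: (measurableT_comp (fine_measurable measurableT) m0).
  apply: (@measurable_fun_limn_esup _ _ _ _ (fun n z => (g (grid n z.1) z.2)%:E)) => n.
  by apply/measurable_EFinP; exact: measurable_grid.
pose D n (z : R * T) := n.+1%:R *
  (difference_limit k (n.+1%:R^-1 + z.1, z.2) - difference_limit k z).
pose F (z : R * T) : \bar R := limn_esup (fun n => (D n z)%:E).
suff m0 : measurable_fun setT F.
  exact: (measurableT_comp (fine_measurable measurableT) m0).
apply: (@measurable_fun_limn_esup _ _ _ _ (fun n z => (D n z)%:E)) => n.
apply/measurable_EFinP; apply: measurable_funM => //.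
apply: measurable_funB => //.
apply: (measurableT_comp IH) => /=; apply/measurable_fun_pairP; split=> //=.
apply: measurable_funD => //; exact: measurable_fst.
exact: measurable_snd.
Qed.

Lemma cvg_grid (t : R) : grid n t @[n --> \oo] --> t.
Proof.
apply/cvgrPdist_lt => e e0; near=> n.
have n0 : 0 < n.+1%:R :> R by [].
rewrite ger0_norm; last first.
  by rewrite subr_ge0 /grid ler_pdivrMr// mulrC floor_le.
have := floorD1_gt (n.+1%:R * t); rewrite intrD => h.
have : n.+1%:R^-1 < e by near: n; exact: (near_infty_natSinv_lt (PosNum e0)).
apply: le_lt_trans; rewrite /grid lerBlDr -[X in X + _]mul1r -mulrDl ler_pdivlMr// mulrC.
by rewrite addrC ltW.
Unshelve. all: by end_near. Qed.

Lemma fine_limn_esup (u : nat -> R) (l : R) : u n @[n --> \oo] --> l ->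
  fine (limn_esup (fun n => (u n)%:E)) = l.
Proof.
move=> ul; rewrite limn_esup_lim.
have {}ul : (u n)%:E @[n --> \oo] --> l%:E by apply: cvg_EFin => //; exact: nearW.
by have /cvg_lim -> := cvg_esups ul.
Qed.

(** On I the upper limits are genuine limits. Since I is open, the shifted points 1 / (n + 1) + t
    eventually lie in I, and the induction hypothesis identifies both terms of the difference
    quotient. *)
Lemma difference_limitE (I : R -> Prop) m y :
  (forall t, I t -> \forall s \near t, I s) ->
  (forall t, I t -> {for t, continuous (g ^~ y)}) ->
  smooth_on I (g ^~ y) m ->
  forall k, (k <= m)%N -> forall t, I t ->
  difference_limit k (t, y) = derive1n k (g ^~ y) t.
Proof.
move=> Io gc gs; elim=> [|k IH] km t It.
  apply: fine_limn_esup; rewrite derive1n0 /=.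
  exact: (cvg_comp _ _ (@cvg_grid t) (gc t It)).
set D := derive1n k (g ^~ y).
have dD : derivable D t 1 by exact: gs.
have h0 : (forall n, n.+1%:R^-1 != 0 :> R) /\ (n.+1%:R^-1 : R) @[n --> \oo] --> 0.
  by split=> [n|]; [rewrite invr_neq0|exact: cvg_harmonic].
have {}dD : h^-1 *: (D (h *: 1 + t) - D t) @[h --> 0^'] --> 'D_1 D t by exact: dD.
rewrite difference_limitS; apply: fine_limn_esup; rewrite derive1nS derive1E -/D.
move/cvgr_dnbhsP : dD => /(_ _ h0).
apply: cvg_trans; apply: near_eq_cvg; near=> n => /=.
rewrite invrK /GRing.scale /= mulr1 !IH ?(ltnW km)//.
near: n.
have ht : (n.+1%:R^-1 + t : R) @[n --> \oo] --> t.
  rewrite -[X in _ --> X]add0r; apply: cvgD; [exact: cvg_harmonic|exact: cvg_cst].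
exact: ht (Io t It).
Unshelve. all: by end_near. Qed.

End measurable_versions.

(** * Expectations of possibly non-measurable versions *)

Section versions.
Import HBNNSimple.
Variables (R : realType) (d : measure_display) (T : measurableType d).
Variable P : probability T R.
Implicit Types (X Y : T -> R).

(** Neither function is assumed measurable, so the integral is a supremum over simple functions
    below it. A simple function below f keeps its integral when set to 0 on the null set, and then
    lies below g everywhere. *)
Lemma ae_le_nonneg_integral (f g : T -> \bar R) :
  (forall x, 0 <= f x)%E -> (forall x, 0 <= g x)%E ->
  {ae P, forall x, f x = g x} -> (\int[P]_x f x <= \int[P]_x g x)%E.
Proof.
move=> f0 g0 [N [mN PN fgN]].
rewrite ge0_integralTE//; apply: ge_ereal_sup => _ [h hf <-].
have mNC : measurable (~` N) by exact: measurableC.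
rewrite -(integralT_nnsfun P h).
rewrite (ge0_negligible_integral mN)//; last 2 first.
- by apply/measurable_EFinP.
- by move=> x _; rewrite lee_fin.
rewrite setTD -[X in integral _ X]setTI integral_mkcondr.
rewrite ge0_integralTE//; last first.
  by move=> x; rewrite patchE; case: ifP => // _; rewrite lee_fin.
rewrite [leRHS]ge0_integralTE//; apply: ge_ereal_sup => _ [k kh <-].
apply: ereal_sup_ubound; exists k => // x; apply: le_trans (kh x) _.
rewrite patchE; case: ifPn => [|_]; last exact: g0.
rewrite inE => Nx; have -> : g x = f x by apply: contrapT => gf; apply/Nx/fgN => /= /esym.
exact: hf.
Qed.

Lemma ae_eq_expectation X Y :
  {ae P, forall w, X w = Y w} -> ('E_P[X] = 'E_P[Y])%E.
Proof.
move=> XY; rewrite unlock integralE [RHS]integralE.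
have YX : {ae P, forall w, Y w = X w} by apply: filterS XY => w ->.
have pos U V : {ae P, forall w, U w = V w} ->
    {ae P, forall w, (EFin \o U)^\+%E w = (EFin \o V)^\+%E w}.
  by move=> UV; apply: filterS UV => w UV; rewrite !funeposE /= UV.
have neg U V : {ae P, forall w, U w = V w} ->
    {ae P, forall w, (EFin \o U)^\-%E w = (EFin \o V)^\-%E w}.
  by move=> UV; apply: filterS UV => w UV; rewrite !funenegE /= UV.
congr (_ - _)%E; apply/eqP; rewrite eq_le; apply/andP; split;
  apply: ae_le_nonneg_integral => //; by [exact: pos|exact: neg].
Qed.

Definition mean X : R := fine 'E_P[X]%E.

Lemma mean_ae X Y : {ae P, forall w, X w = Y w} -> mean X = mean Y.
Proof. by move=> XY; rewrite /mean (ae_eq_expectation XY). Qed.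

Lemma finite_expectation_fin_num X : finite_expectation P X ->
  ('E_P[X])%E \is a fin_num.
Proof.
move=> [X' [iX' XX']]; rewrite (ae_eq_expectation XX').
by rewrite unlock integrable_fin_num.
Qed.

Lemma finite_expectationD X Y : finite_expectation P X -> finite_expectation P Y ->
  finite_expectation P (X \+ Y).
Proof.
move=> [X' [iX' XX']] [Y' [iY' YY']]; exists (X' \+ Y'); split.
  exact: (integrableD measurableT iX' iY').
by apply: filterS2 XX' YY' => w /= -> ->.
Qed.

Lemma meanD X Y : finite_expectation P X -> finite_expectation P Y ->
  mean (X \+ Y) = mean X + mean Y.
Proof.
move=> FX FY; have [X' [iX' XX']] := FX; have [Y' [iY' YY']] := FY.
have e : {ae P, forall w, (X \+ Y) w = (X' \+ Y') w}.
  by apply: filterS2 XX' YY' => w /= -> ->.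
rewrite (mean_ae e) (mean_ae XX') (mean_ae YY') /mean unlock integralD_EFin//.
by rewrite fineD// integrable_fin_num.
Qed.

Lemma finite_expectationZ c X : finite_expectation P X ->
  finite_expectation P (fun w => c * X w).
Proof.
move=> [X' [iX' XX']]; exists (fun w => c * X' w); split.
  exact: (integrableZl measurableT c iX').
by apply: filterS XX' => w /= ->.
Qed.

Lemma meanZ c X : finite_expectation P X -> mean (fun w => c * X w) = c * mean X.
Proof.
move=> FX; have [X' [iX' XX']] := FX.
have e : {ae P, forall w, c * X w = c * X' w} by apply: filterS XX' => w /= ->.
rewrite (mean_ae e) (mean_ae XX') /mean unlock.
under eq_integral do rewrite EFinM.
by rewrite (integralZl measurableT iX') fineM// integrable_fin_num.
Qed.

Lemma finite_expectation_cst c : finite_expectation P (cst c).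
Proof.
exists (cst c); split; last exact: aeW.
exact: finite_measure_integrable_cst.
Qed.

Lemma mean_cst c : mean (cst c) = c.
Proof. by rewrite /mean expectation_cst. Qed.

Lemma finite_expectation_sum (I : Type) (r : seq I) (X : I -> T -> R) :
  (forall i, finite_expectation P (X i)) ->
  finite_expectation P (fun w => \sum_(i <- r) X i w).
Proof.
move=> FX; elim: r => [|i r IH].
  by under eq_fun do rewrite big_nil; exact: finite_expectation_cst.
by under eq_fun do rewrite big_cons; exact: finite_expectationD.
Qed.

Lemma mean_sum (I : Type) (r : seq I) (X : I -> T -> R) :
  (forall i, finite_expectation P (X i)) ->
  mean (fun w => \sum_(i <- r) X i w) = \sum_(i <- r) mean (X i).
Proof.
move=> FX; elim: r => [|i r IH].
  by under eq_fun do rewrite big_nil; rewrite big_nil mean_cst.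
under eq_fun do rewrite big_cons; rewrite meanD//; last exact: finite_expectation_sum.
by rewrite IH big_cons.
Qed.

(** An infinite expectation is covered too, since [fine] sends +oo to 0. *)
Lemma mean_ge0 X : {ae P, forall w, 0 <= X w} -> 0 <= mean X.
Proof.
move=> X0; have e : {ae P, forall w, X w = `|X w|}.
  by apply: filterS X0 => w ?; rewrite ger0_norm.
by rewrite (mean_ae e) fine_ge0// expectation_ge0.
Qed.

Lemma le_mean X Y : finite_expectation P X -> finite_expectation P Y ->
  {ae P, forall w, X w <= Y w} -> mean X <= mean Y.
Proof.
move=> FX FY XY; rewrite -subr_ge0 -mulN1r -meanZ// -meanD//; last first.
  exact: finite_expectationZ.
by apply: mean_ge0; apply: filterS XY => w /= ?; rewrite mulN1r subr_ge0.
Qed.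

(** The bound is known on the full event only; the integrable version is X times the indicator of
    that event. *)
Lemma finite_expectation_bounded (T0 : set T) X M :
  measurable T0 -> P (~` T0) = 0%E -> measurable_fun setT X ->
  (forall w, T0 w -> `|X w| <= M) -> finite_expectation P X.
Proof.
move=> mT0 PT0 mX XM.
exists (fun w => X w * \1_T0 w); split; last first.
  exists (~` T0); split=> //; first exact: measurableC.
  move=> w /=; apply: contra_not => T0w.
  by rewrite indicE mem_set// mulr1.
apply: measurable_bounded_integrable => //.
- by rewrite (le_lt_trans (probability_le1 _ _))// ltry.
- by apply: measurable_funM => //; exact: measurable_indic.
- exists (Num.max M 0); split; first exact: num_real.
  move=> z Mz w _ /=; rewrite normrM indicE.
  have [T0w|T0w] := boolP (w \in T0).
    rewrite normr1 mulr1 (le_trans (XM _ _)) ?inE//; first by rewrite -in_setE.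
    by rewrite (le_trans _ (ltW Mz))// le_max lexx.
  by rewrite normr0 mulr0 (le_trans _ (ltW Mz))// le_max lexx orbT.
Qed.

Lemma norm_mean_le X Y M : finite_expectation P X -> finite_expectation P Y ->
  {ae P, forall w, `|X w - Y w| <= M} -> `|mean X - mean Y| <= M.
Proof.
move=> FX FY XY; rewrite ler_norml; apply/andP; split.
  rewrite lerBrDr addrC -lerBrDr opprK -{1}[M]mean_cst -meanD//; last exact: finite_expectation_cst.
  apply: le_mean => //; first by apply: finite_expectationD => //; exact: finite_expectation_cst.
  by apply: filterS XY => w /=; rewrite ler_norml => /andP[]; lra.
rewrite lerBlDr -{1}[M]mean_cst -meanD//; last exact: finite_expectation_cst.
apply: le_mean => //; first by apply: finite_expectationD => //; exact: finite_expectation_cst.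
by apply: filterS XY => w /=; rewrite ler_norml => /andP[]; lra.
Qed.

End versions.

(** * Discretization *)

Section measurability_lemmas.
Variables (R : realType) (d : measure_display) (T : measurableType d).

Lemma measurable_floor_set (B : set int) : measurable [set x : R | B (Num.floor x)].
Proof.
have -> : [set x : R | B (Num.floor x)] =
    \bigcup_(k : int) (if `[< B k >] then `[k%:~R, (k + 1)%:~R[%classic else set0).
  apply/seteqP; split=> [x /= Bx|x [k _]].
    exists (Num.floor x) => //; rewrite asboolT//= in_itv /=.
    by rewrite floor_le floorD1_gt.
  case: asboolP => //= Bk; rewrite in_itv /= -floor_eq => /eqP xk.
  by rewrite /= xk.
apply: countable_bigcupT_measurable => [|k]; first exact: countableP.
by case: ifP => // _; exact: measurable_itv.
Qed.

Lemma measurable_bigmax (I : finType) (F : I -> T -> R) :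
  (forall i, measurable_fun setT (F i)) ->
  measurable_fun setT (fun w => \big[Num.max/0]_i F i w).
Proof.
move=> mF; under eq_fun do rewrite -big_enum /=.
elim: (enum _) => [|i s IH].
  by under eq_fun do rewrite big_nil; exact: measurable_cst.
by under eq_fun do rewrite big_cons; exact: measurable_maxr.
Qed.

Lemma measurable_gt_set (t : R) (Z : T -> R) : measurable_fun setT Z ->
  measurable [set w | t < Z w].
Proof.
move=> mZ; have -> : [set w | t < Z w] = setT `&` Z @^-1` `]t, +oo[%classic.
  by apply/seteqP; split=> w /=; rewrite in_itv /= andbT// => -[].
exact: mZ.
Qed.

(** The events with threshold t + e increase to the one with threshold t as e decreases to 0. This
    absorbs the error of the discretization. *)
Lemma probability_gt_limit (P : probability T R) (Z : T -> R) (t : R) (c : \bar R) :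
  measurable_fun setT Z ->
  (forall e, 0 < e -> (P [set w | (t + e < Z w)%R] <= c)%E) ->
  (P [set w | (t < Z w)%R] <= c)%E.
Proof.
move=> mZ Pe.
pose E k := [set w | t + k.+1%:R^-1 < Z w].
have -> : [set w | t < Z w] = \bigcup_k E k.
  apply/seteqP; split=> [w /= tZ|w [k _] /=]; last first.
    by apply: lt_trans; rewrite ltrDl invr_gt0.
  have : 0 < Z w - t by rewrite subr_gt0.
  move=> zt; have [k _ hk] := near_infty_natSinv_lt (PosNum zt).
  by exists k => //; rewrite /E /= addrC -ltrBrDr; exact: (hk k (leqnn k)).
have mE k : measurable (E k) by exact: measurable_gt_set.
have cv : P (E k) @[k --> \oo] --> P (\bigcup_k E k).
  apply: nondecreasing_cvg_mu => //; first exact: bigcupT_measurable.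
  move=> k l kl; apply/subsetPset => w; apply: le_lt_trans.
  by rewrite lerD2l lef_pV2 ?posrE// ler_nat ltnS.
rewrite -(cvg_lim _ cv)//; apply: lime_le; first by apply/cvg_ex; eexists; exact: cv.
by apply: nearW => k; apply: Pe; rewrite invr_gt0.
Qed.

End measurability_lemmas.

Section discretization.
Variables (R : realType) (dO dS : measure_display).
Variables (Omega : measurableType dO) (S : measurableType dS) (P : probability Omega R).
Variables (n : nat) (W : 'I_n -> Omega -> S).
Hypothesis W_meas : forall i, measurable_fun setT (W i).
Hypothesis W_indep : mutually_independent P W.
Variable T0 : set Omega.
Hypotheses (T0_meas : measurable T0) (PT0 : P (~` T0) = 0%E).

Lemma full_set_nonempty : exists w, T0 w.
Proof.
apply: contrapT => /forallNP T00.
have : ~` T0 = setT by apply/seteqP; split=> // w _; exact: T00.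
by move: PT0 => + E; rewrite E probability_setT => /eqP; rewrite onee_eq0.
Qed.

Lemma ae_full (Q : Omega -> Prop) : (forall w, T0 w -> Q w) -> {ae P, forall w, Q w}.
Proof.
move=> TQ; exists (~` T0); split=> //; first exact: measurableC.
by move=> w /= nQ T0w; apply: nQ; exact: TQ.
Qed.

(* Cells are represented by sample points of the full event [T0], so that all the
   pointwise relations between the [g i k] survive the discretization exactly. *)
Lemma discretize (K : finType) (g : 'I_n -> K -> S -> R) (M e : R) :
  (forall i k, measurable_fun setT (g i k)) ->
  (forall i k w, T0 w -> `|g i k (W i w)| <= M) -> 0 < e ->
  exists (A : finType) (c : 'I_n -> Omega -> A) (rep : 'I_n -> A -> Omega),
  [/\ forall i a, T0 (rep i a),
      forall i k w, T0 w -> `|g i k (W i w) - g i k (W i (rep i (c i w)))| <= e,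
      forall i a, measurable (c i @^-1` [set a])
    & forall s : 'I_n -> A, P (\bigcap_(i in setT) (c i @^-1` [set s i])) =
        (\prod_i P (c i @^-1` [set s i]))%E].
Proof.
move=> mg gM e0.
(* For |x| <= M the integer floor ((x + M) / e) lies between 0 and B, so [inord] does not truncate
   on the full event, and equal codes mean a distance below e. *)
pose B := `|Num.floor (2 * M / e)|%N.
pose code (x : R) : 'I_B.+1 := inord `|Num.floor ((x + M) / e)|%N.
pose A := {ffun K -> 'I_B.+1}.
pose cell i (z : S) : A := [ffun k => code (g i k z)].
have mcode (a : 'I_B.+1) : measurable [set x | code x = a].
  have -> : [set x | code x = a] = (fun x : R => (x + M) / e) @^-1`
      [set y | [set z | inord `|z|%N = a :> 'I_B.+1] (Num.floor y)] by [].
  rewrite -[X in measurable X]setTI.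
  have mf : measurable_fun setT (fun x : R => (x + M) / e).
    by apply: measurable_funM => //; exact: measurable_funD.
  by apply: mf => //; exact: measurable_floor_set.
have mcell i a : measurable (cell i @^-1` [set a]).
  have -> : cell i @^-1` [set a] = \bigcap_(k in setT) (g i k @^-1` [set x | code x = a k]).
    apply/seteqP; split=> [z /= <- k _|z /= h]; first by rewrite ffunE.
    by apply/ffunP => k; rewrite ffunE; exact: h.
  apply: fin_bigcap_measurable => //= k _.
  by rewrite -[X in measurable X]setTI; exact: mg.
pose c i w := cell i (W i w).
have [w0 T0w0] := full_set_nonempty.
(* A representative must lie in its cell only if the cell meets T0; for the other cells any point of
   T0 will do. *)
have /choice[rep repP] : forall ia : 'I_n * A, exists w, T0 w /\
    ((exists2 w', T0 w' & c ia.1 w' = ia.2) -> c ia.1 w = ia.2).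
  move=> ia; case: (pselect (exists2 w', T0 w' & c ia.1 w' = ia.2)) => [[w' Tw' cw']|nw].
    by exists w'.
  by exists w0.
exists A, c, (fun i a => rep (i, a)); split.
- by move=> i a; have [] := repP (i, a).
- move=> i k w Tw; have [] := repP (i, c i w); set w' := rep _ => Tw' /(_ _)/= cw'.
  have {}cw' : c i w' = c i w by apply: cw'; exists w.
  have := congr1 (fun F : A => F k) cw'; rewrite !ffunE => /(congr1 val).
  have bd x : `|x| <= M -> (`|Num.floor ((x + M) / e)|%N < B.+1)%N /\
      0 <= Num.floor ((x + M) / e).
    rewrite ler_norml => /andP[x1 x2].
    have h0 : 0 <= Num.floor ((x + M) / e).
      by rewrite floor_ge0 divr_ge0 ?(ltW e0)//; lra.
    split=> //; rewrite ltnS /B.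
    have h1 : Num.floor ((x + M) / e) <= Num.floor (2 * M / e).
      by apply: le_floor; rewrite ler_pM2r ?invr_gt0//; lra.
    by rewrite -lez_nat !gez0_abs// (le_trans h0).
  have [b1 p1] := bd _ (gM i k w Tw); have [b2 p2] := bd _ (gM i k w' Tw').
  rewrite /= !inordK// => /(congr1 Posz); rewrite !gez0_abs// => fE.
  have := floor_itv ((g i k (W i w) + M) / e).
  have := floor_itv ((g i k (W i w') + M) / e); rewrite fE => /andP[h1 h2] /andP[h3 h4].
  move: h2 h4 h1 h3; rewrite intrD !ltr_pdivrMr// !ler_pdivlMr// mulrDl mul1r.
  by rewrite ler_norml; lra.
- move=> i a; have := @W_meas i measurableT _ (mcell i a).
  by rewrite setTI.
- move=> s; have := W_indep [set: 'I_n]%SET (B := fun i => cell i @^-1` [set s i]).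
  move=> /(_ (fun i => mcell i (s i))) => E.
  rewrite (_ : \bigcap_(i in setT) _ =
     \bigcap_(i in [set` [set: 'I_n]%SET]) W i @^-1` (cell i @^-1` [set s i])).
    by rewrite E; apply: eq_bigl => i; rewrite inE.
  by apply/seteqP; split=> w h i _; apply: h => //=; rewrite inE.
Qed.

Section finite_valued.
Variables (A : finType) (c : 'I_n -> Omega -> A).
Hypothesis c_meas : forall i a, measurable (c i @^-1` [set a]).
Hypothesis c_indep : forall s : 'I_n -> A,
  P (\bigcap_(i in setT) (c i @^-1` [set s i])) = (\prod_i P (c i @^-1` [set s i]))%E.

Lemma mean_indic (E : set Omega) : measurable E ->
  finite_expectation P (\1_E : Omega -> R) /\ mean P (\1_E) = fine (P E).
Proof.
move=> mE; split; last by rewrite /mean expectation_indic.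
apply: (@finite_expectation_bounded _ _ _ _ setT _ 1) => //.
- by rewrite setCT measure0.
- by move=> w _; rewrite indicE; case: (_ \in _); rewrite ?normr1 ?normr0.
Qed.

Lemma mean_finite (B : finType) (b : Omega -> B) (F : B -> R) :
  (forall x, measurable (b @^-1` [set x])) ->
  finite_expectation P (F \o b) /\
  mean P (F \o b) = \sum_x fine (P (b @^-1` [set x])) * F x.
Proof.
move=> mb.
have E : F \o b = fun w => \sum_x F x * \1_(b @^-1` [set x]) w.
  apply/funext => w /=; rewrite (bigD1 (b w))//= indicE mem_set// mulr1 big1 ?addr0//.
  move=> x xb; rewrite indicE memNset ?mulr0//= => bx.
  by rewrite bx eqxx in xb.
have FE x : finite_expectation P (fun w => F x * \1_(b @^-1` [set x]) w).
  by apply: finite_expectationZ; exact: (mean_indic (mb x)).1.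
rewrite E; split; first exact: finite_expectation_sum.
rewrite mean_sum//; apply: eq_bigr => x _.
by rewrite meanZ ?(mean_indic (mb x)).2 1?mulrC//; exact: (mean_indic (mb x)).1.
Qed.

Lemma pmf_finite i : pmf (fun a => fine (P (c i @^-1` [set a]))).
Proof.
split=> [a|]; first exact/fine_ge0/measure_ge0.
have [_] := mean_finite (fun=> 1) (c_meas i); rewrite mean_cst => ->.
by apply: eq_bigr => a _; rewrite mulr1.
Qed.

(** Independence factors the joint law into the product weights of [prodmean]; this is the bridge
    between means over Omega and iterated finite sums. *)
Lemma mean_joint (F : {ffun 'I_n -> A} -> R) :
  finite_expectation P (fun w => F [ffun i => c i w]) /\
  mean P (fun w => F [ffun i => c i w]) =
  \sum_(s : {ffun 'I_n -> A}) (\prod_i fine (P (c i @^-1` [set s i]))) * F s.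
Proof.
pose b w := [ffun i => c i w].
have bE (s : {ffun 'I_n -> A}) : b @^-1` [set s] = \bigcap_(i in setT) (c i @^-1` [set s i]).
  apply/seteqP; split=> [w /= <- i _|w /= h]; first by rewrite ffunE.
  by apply/ffunP => i; rewrite ffunE; exact: h.
have mb s : measurable (b @^-1` [set s]).
  by rewrite bE; exact: fin_bigcap_measurable.
have [FE ->] := mean_finite F mb; split=> //.
apply: eq_bigr => s _; congr (_ * _); rewrite bE c_indep.
pose r i := fine (P (c i @^-1` [set s i])).
have -> : (\prod_i P (c i @^-1` [set s i]))%E = (\prod_i r i)%:E; last by [].
rewrite (@big_morph _ _ EFin 1%E *%E 1 *%R) //.
by apply: eq_bigr => i _; rewrite fineK// fin_num_measure.
Qed.

End finite_valued.
End discretization.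

(** * Tail bound for one multi-index *)

Lemma supn_diff_le (R : realType) (V : finType) (x y : {ffun V -> R}) (e : R) :
  0 <= e -> (forall v, `|x v - y v| <= e) -> supn x <= supn y + e.
Proof.
move=> e0 xy; have := supn_lip x y; rewrite ler_norml => /andP[_].
have : supn (x - y) <= e by apply: supn_le => // v; rewrite !ffunE.
lra.
Qed.

Lemma sqrtr_add_le (R : realType) (x y : R) : 0 <= x -> 0 <= y ->
  Num.sqrt (x + y) <= Num.sqrt x + Num.sqrt y.
Proof.
move=> x0 y0; rewrite -(ler_pXn2r (_ : 0 < 2)%N) ?nnegrE ?sqrtr_ge0 ?addr_ge0 ?sqrtr_ge0//.
rewrite sqrrD !sqr_sqrtr ?addr_ge0// -addrA lerD2l lerDr.
by rewrite mulrn_wge0// mulr_ge0 ?sqrtr_ge0.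
Qed.

Section tail_bound.
Variables (R : realType) (dO dS : measure_display).
Variables (Omega : measurableType dO) (S : measurableType dS) (P : probability Omega R).
Variables (n p : nat) (W : 'I_n.+1 -> Omega -> S) (V : finType).
Hypothesis W_meas : forall i, measurable_fun setT (W i).
Hypothesis W_indep : mutually_independent P W.
Variable T0 : set Omega.
Hypotheses (T0_meas : measurable T0) (PT0 : P (~` T0) = 0%E).
Variables (f : 'I_n.+1 -> V -> S -> R) (eta : 'I_n.+1 -> 'I_p -> S -> R).
Variables (wt : 'I_n.+1 -> S -> R) (u : V -> 'I_p -> R) (L D phi : R).
Hypotheses (f_meas : forall i v, measurable_fun setT (f i v))
  (eta_meas : forall i j, measurable_fun setT (eta i j))
  (wt_meas : forall i, measurable_fun setT (wt i)).
Hypotheses (p_gt0 : (0 < p)%N) (L_ge0 : 0 <= L) (D_ge0 : 0 <= D) (phi_ge0 : 0 <= phi).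

Let t i v z : R := \sum_(j < p) eta i j z * u v j.

Hypothesis f_le : forall i v w, T0 w -> `|f i v (W i w)| <= L * `|t i v (W i w)|.
Hypothesis f_lip : forall i v v' w, T0 w ->
  `|f i v (W i w) - f i v' (W i w)| <= L * `|t i v (W i w) - t i v' (W i w)|.
Hypothesis f_wt : forall i v w, T0 w -> `|f i v (W i w)| <= phi * `|wt i (W i w)|.
Hypothesis wt_le1 : forall i w, T0 w -> `|wt i (W i w)| <= 1.
Hypothesis eta_le1 : forall i j w, T0 w -> `|eta i j (W i w)| <= 1.
Hypothesis u_le : forall v, \sum_(j < p) `|u v j| <= D.

Definition centered_sup (w : Omega) : R :=
  supn [ffun v => \sum_i (f i v (W i w) - mean P (f i v \o W i))].

Definition eta_norm (w : Omega) : R :=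
  Num.sqrt (\big[Num.max/0]_(j < p) \sum_i eta i j (W i w) ^+ 2).

Definition wt_var : R := \sum_i mean P (fun w => wt i (W i w) ^+ 2).

Lemma measurable_centered_sup : measurable_fun setT centered_sup.
Proof.
apply: (measurable_bigmax (F := fun v w => `| _ |)) => v.
under eq_fun do rewrite ffunE.
apply: (@measurableT_comp _ _ _ _ _ _ (@Num.norm R R)) => //.
apply: measurable_sum => i; apply: measurable_funB => //.
exact: measurableT_comp.
Qed.

Lemma finite_expectation_eta_norm : finite_expectation P eta_norm.
Proof.
apply: (@finite_expectation_bounded _ _ _ _ T0 _ (Num.sqrt n.+1%:R)) => //.
  apply: (@measurableT_comp _ _ _ _ _ _ (@Num.sqrt R)).
    by apply: continuous_measurable_fun; exact: sqrt_continuous.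
  apply: measurable_bigmax => j; apply: measurable_sum => i.
  by apply: measurable_funX; exact: measurableT_comp.
move=> w Tw; rewrite ger0_norm ?sqrtr_ge0// ler_wsqrtr//.
apply: bigmax_le => // j _; have -> : n.+1%:R = \sum_(i < n.+1) 1 :> R.
  by rewrite sumr_const card_ord.
apply: ler_sum => i _; rewrite -real_normK ?num_real// exprn_ile1//.
exact: eta_le1.
Qed.

Lemma centered_sup_tail (x : R) : 0 < x ->
  (P [set w | (8 * L * D * Num.sqrt (2 * ln (2 * p%:R)) * mean P eta_norm
    + phi * Num.sqrt wt_var * Num.sqrt (2 * x) + 8 * phi * x < centered_sup w)%R]
   <= (expR (- x))%:E)%E.
Proof.
move=> x0; set cA := 8 * L * D * _; set cB := Num.sqrt (2 * x).
apply: probability_gt_limit => [|del del0]; first exact: measurable_centered_sup.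
have cA0 : 0 <= cA by rewrite !mulr_ge0 ?sqrtr_ge0.
have cB0 : 0 <= phi * cB by rewrite mulr_ge0 ?sqrtr_ge0.
(* Discretization costs [kap] in the mean of [eta_norm], [kap] in the standard deviation and
   [kap ^+ 2] in the supremum. As kap <= 1, the total is at most kap * K <= del. *)
pose K := 1 + cA + phi * cB.
have K0 : 0 < K by rewrite /K; lra.
pose kap := Num.min 1 (del / K).
have kap0 : 0 < kap by rewrite lt_min ltr01 divr_gt0.
have kap1 : kap <= 1 by rewrite ge_min lexx.
have kapK : kap * K <= del by rewrite -ler_pdivlMr// ge_min lexx orbT.
(* The n + 1 summands each err by at most 2 e, which makes [kap ^+ 2] in total; under a square root
   this becomes [kap]. *)
pose e := kap ^+ 2 / (2 * n.+1%:R).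
have e0 : 0 < e by rewrite divr_gt0 ?exprn_gt0 ?mulr_gt0.
have ne : n.+1%:R * (2 * e) = kap ^+ 2.
  by rewrite /e; field; rewrite nat1r pnatr_eq0.
(* The families f, eta and wt are discretized together, so that a single representative carries all
   the inequalities between them. *)
pose G i (k : V + 'I_p + unit) : S -> R := match k with
  | inl (inl v) => f i v | inl (inr j) => eta i j | inr _ => wt i end.
have mG i k : measurable_fun setT (G i k) by case: k => [[v|j]|] /=.
have GM i k w : T0 w -> `|G i k (W i w)| <= 1 + phi.
  move=> Tw; case: k => [[v|j]|_] /=.
  - rewrite (le_trans (f_wt _ _ Tw))// (@le_trans _ _ phi)//; last by rewrite lerDr.
    by rewrite -[leRHS]mulr1 ler_wpM2l// wt_le1.
  - by rewrite (le_trans (eta_le1 _ _ Tw))// lerDl.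
  - by rewrite (le_trans (wt_le1 _ Tw))// lerDl.
have [A [c [rep [repT0 Ge mc ic]]]] := discretize W_meas W_indep PT0 mG GM e0.
(* [finite_tail] indexes the variables by natural numbers; [inord] is the identity on the indices
   below n + 1 that occur in its conclusion. *)
pose q (k : nat) (a : A) := fine (P (c (inord k) @^-1` [set a])).
have q_pmf k : pmf (q k) by exact: (pmf_finite P mc).
pose z k a := W (inord k) (rep (inord k) a).
pose f' k a : {ffun V -> R} := [ffun v => f (inord k) v (z k a)].
pose eta' k a j := eta (inord k) j (z k a).
pose wt' k a := wt (inord k) (z k a).
have zT0 k a : T0 (rep (inord k) a) by [].
have tl := @finite_tail R A V p n.+1 q q_pmf f' eta' u wt' L D phi p_gt0 L_ge0 D_ge0 phi_ge0.
have {tl} := tl _ _ _ u_le x x0.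
have h1 k a : dominated (f' k a) [ffun v => L * \sum_(j < p) eta' k a j * u v j].
  split=> [v|v v']; rewrite !ffunE.
    by rewrite normrM (ger0_norm L_ge0); exact: f_le.
  by rewrite -mulrBr normrM (ger0_norm L_ge0); exact: f_lip.
have h2 k a v : `|f' k a v| <= phi * `|wt' k a| by rewrite ffunE; exact: f_wt.
have h3 k a : `|wt' k a| <= 1 by exact: wt_le1.
pose EF (s : {ffun 'I_n.+1 -> A}) : R :=
  Num.sqrt (\big[Num.max/0]_(j < p) \sum_(i < n.+1) eta' i (s i) j ^+ 2).
pose E' := prodmean q EF.
pose T' := cA * E' + phi * Num.sqrt (\sum_(i < n.+1) \sum_a q i a * wt' i a ^+ 2) * cB +
  8 * phi * x.
pose IF (s : {ffun 'I_n.+1 -> A}) : R :=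
  (T' < supn (\sum_(i < n.+1) fcent q f' i (s i)))%R%:R.
move=> /(_ h1 h2 h3) tl; have {}tl : prodmean q IF <= expR (- x) by exact: tl.
have jm F := mean_joint mc ic F.
have pmE (F : {ffun 'I_n.+1 -> A} -> R) :
    prodmean q F = mean P (fun w => F [ffun i => c i w]).
  rewrite (jm F).2 /prodmean; apply: eq_bigr => s _; congr (_ * _).
  by apply: eq_bigr => i _; rewrite /q inord_val.
have sq_le (a b : R) : `|a| <= 1 -> `|b| <= 1 -> `|a - b| <= e -> b ^+ 2 <= a ^+ 2 + 2 * e.
  by rewrite !ler_norml => /andP[? ?] /andP[? ?] /andP[? ?]; nra.
have ze (i : 'I_n.+1) a : z i a = W i (rep i a) by rewrite /z inord_val.
have gd i k w : T0 w -> `|G i k (W i w) - G i k (z i (c i w))| <= e.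
  by move=> Tw; rewrite /z inord_val; exact: Ge.
have kap2 : 0 <= kap ^+ 2 by rewrite sqr_ge0.
have sum_kap2 : \sum_(i < n.+1) 2 * e = kap ^+ 2.
  by rewrite sumr_const card_ord -[_ *+ n.+1]mulr_natl.
have FE_eta := finite_expectation_eta_norm.
have E'le : E' <= mean P eta_norm + kap.
  rewrite /E' pmE.
  rewrite -[X in _ <= _ + X](mean_cst P) -meanD//; last exact: finite_expectation_cst.
  apply: le_mean; first exact: (jm EF).1.
    by apply: finite_expectationD => //; exact: finite_expectation_cst.
  apply: (ae_full T0_meas PT0) => w Tw; rewrite /EF /=.
  rewrite -[X in _ <= _ + X](ger0_norm (ltW kap0)) -sqrtr_sqr.
  apply: le_trans (sqrtr_add_le _ kap2); last exact: bigmax_ge_id.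
  rewrite ler_wsqrtr//; apply: bigmax_le => [|j _].
    by rewrite addr_ge0//; exact: bigmax_ge_id.
  apply: le_trans (lerD (le_bigmax _ (fun j => \sum_i eta i j (W i w) ^+ 2) j) (lexx _)).
  rewrite -sum_kap2 -big_split /=; apply: ler_sum => i _; rewrite ffunE.
  have := gd i (inl (inr j)) w Tw; rewrite /= /eta' inord_val => hd.
  by apply: sq_le; rewrite // ?ze; exact: eta_le1.
have varle : \sum_(i < n.+1) \sum_a q i a * wt' i a ^+ 2 <= wt_var + kap ^+ 2.
  rewrite -sum_kap2 -big_split /=; apply: ler_sum => i _.
  have [FE ->] : finite_expectation P ((fun a => wt' i a ^+ 2) \o c i) /\
      \sum_a q i a * wt' i a ^+ 2 = mean P ((fun a => wt' i a ^+ 2) \o c i).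
    have [FE ->] := mean_finite P (fun a => wt' i a ^+ 2) (mc i); split=> //.
    by apply: eq_bigr => a _; rewrite /q inord_val.
  have FE2 : finite_expectation P (fun w => wt i (W i w) ^+ 2).
    apply: (@finite_expectation_bounded _ _ _ _ T0 _ 1) => //.
      by apply: measurable_funX; exact: measurableT_comp.
    by move=> w Tw; rewrite normrX exprn_ile1// wt_le1.
  rewrite -[2 * e](mean_cst P) -meanD//; last exact: finite_expectation_cst.
  apply: le_mean => //; first by apply: finite_expectationD => //; exact: finite_expectation_cst.
  apply: (ae_full T0_meas PT0) => w Tw /=.
  have := gd i (inr tt) w Tw; rewrite /= /wt' inord_val => hd.
  by apply: sq_le; rewrite // ?ze; exact: wt_le1.
(* Each summand errs by e in its value and by another e in its mean. *)
have fc w : T0 w ->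
    centered_sup w <= supn (\sum_(i < n.+1) fcent q f' i (c i w)) + kap ^+ 2.
  move=> Tw; apply: supn_diff_le => // v.
  rewrite ffunE sum_ffunE -sumrB -sum_kap2.
  apply: le_trans (ler_norm_sum _ _ _) _; apply: ler_sum => i _.
  have -> : fcent q f' i (c i w) v = f i v (z i (c i w)) -
      mean P ((fun a => f i v (z i a)) \o c i).
    rewrite (mean_finite P _ (mc i)).2 /fcent /fmean !ffunE sum_ffunE /f' inord_val.
    by congr (_ - _); apply: eq_bigr => a _; rewrite !ffunE /q inord_val.
  rewrite opprD opprK addrACA mulr_natl mulr2n (le_trans (ler_normD _ _))//.
  apply: lerD; first exact: (gd i (inl (inl v))).
  rewrite addrC; apply: norm_mean_le; first exact: (mean_finite P _ (mc i)).1.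
    apply: (@finite_expectation_bounded _ _ _ _ T0 _ (1 + phi)) => //.
      exact: measurableT_comp.
    by move=> w' Tw'; exact: (GM i (inl (inl v))).
  by apply: (ae_full T0_meas PT0) => w' Tw' /=; rewrite distrC; exact: (gd i (inl (inl v))).
set T := _ + 8 * phi * x.
have T'T : T' + kap ^+ 2 <= T + del.
  have s1 := ler_wpM2l cA0 E'le.
  have var0 : 0 <= wt_var.
    by apply: sumr_ge0 => i _; apply: mean_ge0; apply: aeW => w; exact: sqr_ge0.
  have s2 : Num.sqrt (\sum_(i < n.+1) \sum_a q i a * wt' i a ^+ 2) <=
      Num.sqrt wt_var + kap.
    rewrite -[X in _ <= _ + X](ger0_norm (ltW kap0)) -sqrtr_sqr.
    by apply: le_trans (sqrtr_add_le _ kap2); rewrite // ler_wsqrtr.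
  have s3 := ler_wpM2l cB0 s2.
  move: kapK; rewrite /T' /T /K; nra.
have mE : measurable [set w | (T + del < centered_sup w)%R].
  by apply: measurable_gt_set; exact: measurable_centered_sup.
rewrite -(fineK (fin_num_measure P _ mE)) lee_fin.
apply: le_trans tl; rewrite -(mean_indic P mE).2 pmE.
apply: le_mean; [exact: (mean_indic P mE).1|exact: (jm IF).1|].
apply: (ae_full T0_meas PT0) => w Tw; rewrite indicE.
have [|_] := boolP (w \in _); last by rewrite /IF; exact: ler0n.
rewrite inE /= => Tw'; rewrite /IF.
suff -> : T' < supn (\sum_(i < n.+1) fcent q f' i ([ffun i => c i w] i)) by [].
have -> : \sum_(i < n.+1) fcent q f' i ([ffun i => c i w] i) =
    \sum_(i < n.+1) fcent q f' i (c i w) by apply: eq_bigr => i _; rewrite ffunE.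
by have := fc w Tw; lra.
Qed.

End tail_bound.

(** * Vectors and tensors *)

Section vector_lemmas.
Variable R : realType.

Lemma dotvE n (a b : 'cV[R]_n) : dotv a b = \sum_j a j 0 * b j 0.
Proof. by rewrite /dotv mxE; apply: eq_bigr => j _; rewrite mxE. Qed.

Lemma dotvB n (a b c : 'cV[R]_n) : dotv a (b - c) = dotv a b - dotv a c.
Proof. by rewrite !dotvE -sumrB; apply: eq_bigr => j _; rewrite !mxE mulrBr. Qed.

Lemma dotv_kronv m n (a a' : 'cV[R]_m) (b b' : 'cV[R]_n) :
  dotv (kronv a b) (kronv a' b') = dotv a a' * dotv b b'.
Proof.
rewrite {1}/dotv /kronv trmxK -{1}[a]trmxK mxvec_dotmul !mulmxA -mulmxA trmxK.
rewrite [X in X *m _]mx11_scalar [X in _ *m X]mx11_scalar -scalar_mxM mxE eqxx mulr1n.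
by rewrite -/(dotv a a') -/(dotv b' b) !dotvE; congr (_ * _); apply: eq_bigr => j _; exact: mulrC.
Qed.

Lemma dotv_tensor_pow p (a b : 'cV[R]_p) k :
  dotv (tensor_pow a k) (tensor_pow b k) = dotv a b ^+ k.
Proof.
elim: k => [|k IH]; first by rewrite dotvE big_ord1 !mxE mulr1.
by rewrite /= dotv_kronv IH exprS.
Qed.

Lemma exprn_sum_ffun (p k : nat) (x : 'I_p -> R) :
  (\sum_j x j) ^+ k = \sum_(J : {ffun 'I_k -> 'I_p}) \prod_l x (J l).
Proof.
rewrite -(bigA_distr_bigA (fun (_ : 'I_k) j => x j)) /=.
by rewrite prodr_const card_ord.
Qed.

Lemma wnorm1_ge0 p (d : 'I_p -> R) (v : 'cV[R]_p) : (forall j, 0 < d j) -> 0 <= wnorm1 d v.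
Proof. by move=> d0; apply: sumr_ge0 => j _; rewrite mulr_ge0// ltW. Qed.

(** One point of D is chosen in each cube of side 1 / (k + 1) that meets D; there are countably many
    cubes over all k. *)
Lemma dense_sequence p (D : set 'cV[R]_p) : (exists v, D v) ->
  exists vs : nat -> 'cV[R]_p, (forall k, D (vs k)) /\
    forall v e, D v -> 0 < e -> exists k, forall j, `|vs k j 0 - v j 0| < e.
Proof.
move=> [v0 Dv0].
pose I := ({ffun 'I_p -> int} * nat)%type.
pose cell (i : I) (v : 'cV[R]_p) := forall j, Num.floor (i.2.+1%:R * v j 0) = i.1 j.
have /choice[r rP] : forall i : I, exists v, D v /\ ((exists2 w, D w & cell i w) -> cell i v).
  move=> i; case: (pselect (exists2 w, D w & cell i w)) => [[w Dw cw]|nw]; last by exists v0.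
  by exists w.
exists (fun k => if unpickle k is Some i then r i else v0); split.
  by move=> k; case: (unpickle k) => [i|]//; have [] := rP i.
move=> v e Dv e0.
have [k _ hk] := near_infty_natSinv_lt (PosNum e0).
pose i : I := ([ffun j => Num.floor (k.+1%:R * v j 0)], k).
exists (pickle i) => j; rewrite pickleK.
have [_ /(_ _)/= ri] := rP i.
have {}ri : cell i (r i) by apply: ri; exists v => // j'; rewrite ffunE.
have := ri j; rewrite ffunE /= => fE.
have := floor_itv (k.+1%:R * v j 0); have := floor_itv (k.+1%:R * r i j 0).
rewrite fE intrD => /andP[h1 h2] /andP[h3 h4].
apply: lt_trans (hk k (leqnn k)); rewrite -[ltRHS]mul1r ltr_pdivlMr//.
rewrite -[X in _ * X](ger0_norm (ler0n R k.+1)) -normrM mulrBl ltr_norml; lra.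
Qed.

(* AM-GM applied to the [m]-th powers of the factors. *)
Lemma prod_le_mean_pow (m : nat) (y : 'I_m -> R) : (0 < m)%N -> (forall l, 0 <= y l) ->
  \prod_l y l <= m%:R^-1 * \sum_l y l ^+ m.
Proof.
move=> m0 y0.
have [|+ _] := @leif_AGM R 'I_m predT (fun l => y l ^+ m).
  by move=> l _ /=; rewrite exprn_ge0.
rewrite card_ord /= => AGM; have {AGM} : \prod_l y l ^+ m <= ((\sum_l y l ^+ m) / m%:R) ^+ m.
  exact: AGM.
rewrite prodrXl ler_pXn2r ?nnegrE//.
- by rewrite mulrC.
- by apply: prodr_ge0.
- by rewrite mulr_ge0// sumr_ge0// => l _; rewrite exprn_ge0.
Qed.

Lemma cvg_sum_seq (K : Type) (r : seq K) (F : K -> nat -> R) (l : K -> R) :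
  (forall i, F i k @[k --> \oo] --> l i) ->
  \sum_(i <- r) F i k @[k --> \oo] --> \sum_(i <- r) l i.
Proof.
move=> Fl; elim: r => [|i r IH].
  by rewrite big_nil; under eq_fun do rewrite big_nil; exact: cvg_cst.
by rewrite big_cons; under eq_fun do rewrite big_cons; exact: cvgD.
Qed.

Lemma cvg_prod_seq (K : Type) (r : seq K) (F : K -> nat -> R) (l : K -> R) :
  (forall i, F i k @[k --> \oo] --> l i) ->
  \prod_(i <- r) F i k @[k --> \oo] --> \prod_(i <- r) l i.
Proof.
move=> Fl; elim: r => [|i r IH].
  by rewrite big_nil; under eq_fun do rewrite big_nil; exact: cvg_cst.
by rewrite big_cons; under eq_fun do rewrite big_cons; exact: cvgM.
Qed.

End vector_lemmas.

(** * The remainder process *)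

(** The square makes the base of [powR] nonnegative, as [powR_inv1] requires; where f vanishes both
    sides are 0. *)
Lemma measurable_inv_fun (R : realType) (d : measure_display) (T : measurableType d)
  (f : T -> R) : measurable_fun setT f -> measurable_fun setT (fun x => (f x)^-1).
Proof.
move=> mf; have -> : (fun x => (f x)^-1) = (fun x => f x * powR (f x ^+ 2) (-1)).
  apply/funext => x; rewrite powR_inv1 ?sqr_ge0//.
  have [->|fx0] := eqVneq (f x) 0; first by rewrite invr0 mul0r.
  by rewrite expr2 invfM mulrA divff// mul1r.
apply: measurable_funM => //.
have mf2 : measurable_fun setT (fun x => f x ^+ 2) by exact: measurable_funX.
exact: (measurableT_comp (@measurable_powR R (-1)) mf2).
Qed.

Section remainder_process.
Variables (R : realType) (dO dY dZ : measure_display)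
  (Omega : measurableType dO) (Ys : measurableType dY) (Zs : measurableType dZ)
  (P : probability Omega R) (n p : nat) (p_gt0 : (0 < p)%N)
  (Y : 'I_n.+1 -> {RV P >-> Ys}) (Z : 'I_n.+1 -> {RV P >-> Zs})
  (YZ_indep : mutually_independent P (fun i w => (Y i w, Z i w)))
  (gamma : 'I_n.+1 -> R -> Ys -> R)
  (gamma_meas : forall i t, measurable_fun setT (gamma i t))
  (h : Zs -> 'cV[R]_p)
  (h_meas : forall j, measurable_fun setT (fun z => h z j 0))
  (D0 : set 'cV[R]_p) (m : nat) (a b : 'I_n.+1 -> \bar R) (Fm Fm1 : R)
  (d : 'I_p -> R)
  (Hreg : regularity Y gamma m a b Fm Fm1)
  (Hbnd : boundedness Z h d)
  (Hdom : parameter_domain Z h D0 a b)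
  (theta : 'cV[R]_p) (D0_theta : D0 theta)
  (Hexp : finite_expectations Y Z gamma h D0 m theta).

Let I i t := inab a b i t.

Definition regular_at w := [/\ forall i, smooth_on (I i) (gamma i ^~ (Y i w)) m,
  forall i t, I i t -> `|derive1n m (gamma i ^~ (Y i w)) t| <= Fm &
  forall i, lipschitz_on (I i) Fm1 (derive1n m (gamma i ^~ (Y i w)))].

Definition bounded_at w := forall j i, `|h (Z i w) j 0| <= d j.

Definition domain_at w := forall v, D0 v -> forall i, I i (dotv (h (Z i w)) v).

Lemma good_event : exists T0 : set Omega, [/\ measurable T0, P (~` T0) = 0%E &
  forall w, T0 w -> [/\ regular_at w, bounded_at w & domain_at w]].
Proof.
have [N [mN PN NP]] : {ae P, forall w, [/\ regular_at w, bounded_at w & domain_at w]}.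
  apply: filterS3 Hreg.2 Hbnd.2 Hdom => w reg bnd dom; split=> //.
  split=> [i k km t It|i t It|i t u It Iu]; have [h1 h2 h3] := reg i.
  - exact: h1.
  - exact: h2.
  - exact: h3.
exists (~` N); split; [exact: measurableC|by rewrite setCK|].
by move=> w Nw; apply: contrapT => nw; apply/Nw/NP.
Qed.

Lemma interval_inab i : interval_set (I i).
Proof.
move=> s t u; rewrite /I /inab => /andP[as_ sb] /andP[at_ tb] /andP[su ut].
apply/andP; split.
  by apply: (@lt_le_trans _ _ (Num.min s t)%:E); [case: (leP s t)|rewrite lee_fin].
by apply: (@le_lt_trans _ _ (Num.max s t)%:E); [rewrite lee_fin|case: (leP s t)].
Qed.

Lemma open_inab i t : I i t -> \forall s \near t, I i s.
Proof.
rewrite /I /inab => /andP[at_ tb].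
have h1 : \forall s \near nbhs t, (a i < s%:E)%E.
  case: (a i) at_ => [r| |] at_; [|by []|by exists 1 => /= [|s _]; [|exact: ltNyr]].
  by apply: filterS (lt_nbhsr at_) => s; rewrite lte_fin.
have h2 : \forall s \near nbhs t, (s%:E < b i)%E.
  case: (b i) tb => [r| |] tb; [|by exists 1 => /= [|s _]; [|exact: ltry]|by []].
  by apply: filterS (lt_nbhsl tb) => s; rewrite lte_fin.
by apply: filterS2 h1 h2 => s -> ->.
Qed.

(** The Lipschitz bound forces its constant to be nonnegative once it is applied at two distinct
    points. *)
Lemma two_points_inab i : exists s t, [/\ I i s, I i t & s != t].
Proof.
have ab := Hreg.1 i.
have [r ar rb] : exists2 r : R, (a i < r%:E)%E & (r%:E < b i)%E.
  case: (a i) (b i) ab => [x| |] [y| |] //= xy.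
  - exists ((x + y) / 2); rewrite lte_fin; move: xy; rewrite lte_fin; lra.
  - by exists (x + 1); rewrite ?ltry// lte_fin ltrDl.
  - by exists (y - 1); rewrite ?ltNyr// lte_fin; lra.
  - by exists 0; rewrite ?ltNyr ?ltry.
have Ir : I i r by rewrite /I /inab ar rb.
have [e /= e0 he] := open_inab Ir.
exists r, (r + e / 2); split=> //.
  apply: he; rewrite /= opprD addNKr normrN ger0_norm; lra.
by rewrite lt_eqF// ltrDl divr_gt0.
Qed.

Variable T0 : set Omega.
Hypotheses (T0_meas : measurable T0) (PT0 : P (~` T0) = 0%E).
Hypothesis T0_good : forall w, T0 w -> [/\ regular_at w, bounded_at w & domain_at w].

Let d_gt0 j : 0 < d j. Proof. exact: Hbnd.1. Qed.

Lemma Fm_ge0 : 0 <= Fm.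
Proof.
have [w Tw] := full_set_nonempty PT0; have [[_ F _] _ _] := T0_good Tw.
have [s [t [Is _ _]]] := two_points_inab ord0.
exact: le_trans (F ord0 s Is).
Qed.

Lemma Fm1_ge0 : 0 <= Fm1.
Proof.
have [w Tw] := full_set_nonempty PT0; have [[_ _ G] _ _] := T0_good Tw.
have [s [t [Is It st]]] := two_points_inab ord0.
have := le_trans (normr_ge0 _) (G ord0 s t Is It).
by rewrite pmulr_lge0// normr_gt0 subr_eq0.
Qed.

Let S := (Ys * Zs)%type.
Let W i w : S := (Y i w, Z i w).
Let lin (v : 'cV[R]_p) (s : S) : R := dotv (h s.2) v.
(** A measurable version of the k-th derivative at h(Z_i)^T v; it agrees with [dgamma] on [T0] for k
    <= m and v in D0. *)
Let der i k v (s : S) : R := difference_limit (gamma i) k (lin v s, s.1).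
Let rem i v (s : S) : R := der i 0 v s -
  \sum_(k < m.+1) k`!%:R^-1 * (der i k theta s * lin (v - theta) s ^+ k).
Let rho i v s : R := rem i v s / lin (v - theta) s ^+ m.
Let eta (i : 'I_n.+1) j (s : S) : R := h s.2 j 0 / d j.
(** The factor d_j is moved from [h] to [v]: [eta] becomes bounded by 1, h(Z_i)^T (v - theta) is the
    sum of the products of [eta] and [u], and the l1 norm of [u v] is [wnorm1 d (v - theta)]. *)
Let u (v : 'cV[R]_p) j : R := d j * (v - theta) j 0.
Let wt (J : {ffun 'I_m -> 'I_p}) (i : 'I_n.+1) (s : S) : R := \prod_l eta i (J l) s.
Let f J i v s : R := rho i v s * wt J i s.
Let L : R := Fm1 / m.+1`!%:R.

Lemma measurable_W i : measurable_fun setT (W i).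
Proof. by apply: measurable_fun_pair; exact: measurable_funP. Qed.

Lemma measurable_lin v : measurable_fun setT (lin v).
Proof.
rewrite /lin; under eq_fun do rewrite dotvE.
apply: measurable_sum => j; apply: measurable_funM => //.
by apply: (measurableT_comp (h_meas j)); exact: measurable_snd.
Qed.

Lemma measurable_der i k v : measurable_fun setT (der i k v).
Proof.
apply: (measurableT_comp (measurable_difference_limit (gamma_meas i) k)).
apply: measurable_fun_pair; [exact: measurable_lin|exact: measurable_fst].
Qed.

Lemma measurable_rem i v : measurable_fun setT (rem i v).
Proof.
apply: measurable_funB; first exact: measurable_der.
apply: measurable_sum => k; apply: measurable_funM => //.
by apply: measurable_funM; [exact: measurable_der|apply: measurable_funX; exact: measurable_lin].
Qed.

Lemma measurable_eta i j : measurable_fun setT (eta i j).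
Proof.
apply: measurable_funM => //.
by apply: (measurableT_comp (h_meas j)); exact: measurable_snd.
Qed.

Lemma measurable_wt J i : measurable_fun setT (wt J i).
Proof. by apply: measurable_prod => l _; exact: measurable_eta. Qed.

Lemma measurable_f J i v : measurable_fun setT (f J i v).
Proof.
apply: measurable_funM; last exact: measurable_wt.
apply: measurable_funM; first exact: measurable_rem.
by apply: measurable_inv_fun; apply: measurable_funX; exact: measurable_lin.
Qed.

Lemma linB v s : lin (v - theta) s = lin v s - lin theta s.
Proof. exact: dotvB. Qed.

Lemma lin_eta i v s : lin (v - theta) s = \sum_(j < p) eta i j s * u v j.
Proof.
rewrite /lin dotvE; apply: eq_bigr => j _.
by rewrite /eta /u mulrA divfK// gt_eqF.
Qed.

Lemma sum_norm_u v : \sum_(j < p) `|u v j| = wnorm1 d (v - theta).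
Proof. by apply: eq_bigr => j _; rewrite normrM (gtr0_norm (d_gt0 j)). Qed.

Lemma norm_lin_le w v v' i : T0 w -> `|lin v (W i w) - lin v' (W i w)| <= wnorm1 d (v - v').
Proof.
move=> Tw; have [_ hd _] := T0_good Tw.
rewrite -dotvB dotvE (le_trans (ler_norm_sum _ _ _))//.
apply: ler_sum => j _; rewrite normrM ler_wpM2r//; exact: (hd j i).
Qed.

Lemma eta_le1 w i j : T0 w -> `|eta i j (W i w)| <= 1.
Proof.
move=> Tw; have [_ hd _] := T0_good Tw.
by rewrite normrM normfV (gtr0_norm (d_gt0 j)) ler_pdivrMr ?mul1r//; exact: (hd j i).
Qed.

Lemma wt_le1 w J i : T0 w -> `|wt J i (W i w)| <= 1.
Proof.
by move=> Tw; rewrite normr_prod prodr_ile1// => l _; rewrite normr_ge0 eta_le1.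
Qed.

Lemma derE w i k v : T0 w -> D0 v -> (k <= m)%N ->
  der i k v (W i w) = dgamma gamma k i (dotv (h (Z i w)) v) (Y i w).
Proof.
move=> Tw Dv km; have [[sm _ lp] _ dm] := T0_good Tw.
apply: (@difference_limitE _ _ _ (gamma i) (I i) m) => //; last exact: dm.
- exact: open_inab.
(* For m > 0 continuity follows from differentiability, for m = 0 from the Lipschitz bound on gamma
   itself; Fm1 + 1 is used to divide by a positive number. *)
- move=> t It; case: (posnP m) => [m0|m0]; last first.
    exact/differentiable_continuous/derivable1_diffP/(sm i 0%N m0 t It).
  have lp0 := lp i; rewrite m0 derive1n0 in lp0.
  have G0 : 0 < Fm1 + 1 by rewrite ltr_wpDl// Fm1_ge0.
  apply/cvgrPdist_lt => e e0; have ts : \forall s \near nbhs t, `|t - s| < e / (Fm1 + 1).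
    by exists (e / (Fm1 + 1)) => //=; rewrite divr_gt0.
  apply: filterS2 ts (open_inab It) => s /= ts Is; apply: le_lt_trans (lp0 _ _ It Is) _.
  apply: (@le_lt_trans _ _ ((Fm1 + 1) * `|t - s|)).
    by rewrite ler_wpM2r// lerDl.
  by rewrite mulrC -ltr_pdivlMr.
Qed.

Let g i w := gamma i ^~ (Y i w).

Lemma remE w i v : T0 w -> D0 v ->
  rem i v (W i w) = taylor_rem (g i w) m (lin theta (W i w)) (lin v (W i w)).
Proof.
move=> Tw Dv; rewrite /rem derE//; congr (_ - _); apply: eq_bigr => k _.
by rewrite derE ?linB// -ltnS.
Qed.

Lemma rhoE w i v : T0 w -> D0 v ->
  rho i v (W i w) = taylor_quot (g i w) m (lin theta (W i w)) (lin v (W i w)).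
Proof. by move=> Tw Dv; rewrite /rho remE// linB. Qed.

Lemma rem_rho w i v : T0 w -> D0 v ->
  rem i v (W i w) = rho i v (W i w) * lin (v - theta) (W i w) ^+ m.
Proof. by move=> Tw Dv; rewrite rhoE// remE// linB; exact: taylor_rem_quot. Qed.

Lemma rho_le w i v : T0 w -> D0 v -> `|rho i v (W i w)| <= 2 * Fm / m`!%:R.
Proof.
move=> Tw Dv; have [[sm hF _] _ dm] := T0_good Tw; rewrite rhoE//.
exact: (taylor_quot_le (@interval_inab i) (sm i) (hF i) (dm _ D0_theta i) (dm _ Dv i) Fm_ge0).
Qed.

Lemma rho_leL w i v : T0 w -> D0 v ->
  `|rho i v (W i w)| <= L * `|lin (v - theta) (W i w)|.
Proof.
move=> Tw Dv; have [[sm _ lp] _ dm] := T0_good Tw; rewrite rhoE// linB.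
exact: (taylor_quot_leS (@interval_inab i) (sm i) (lp i) (dm _ D0_theta i) (dm _ Dv i)).
Qed.

Lemma rho_lip w i v v' : T0 w -> D0 v -> D0 v' ->
  `|rho i v (W i w) - rho i v' (W i w)| <= L * `|lin v (W i w) - lin v' (W i w)|.
Proof.
move=> Tw Dv Dv'; have [[sm _ lp] _ dm] := T0_good Tw; rewrite !rhoE//.
exact: (taylor_quot_lip (@interval_inab i) (sm i) (lp i) (dm _ D0_theta i)
  (dm _ Dv i) (dm _ Dv' i)).
Qed.

Lemma L_ge0 : 0 <= L. Proof. by rewrite divr_ge0 ?Fm1_ge0. Qed.

Lemma wnorm_le_diam v v' : D0 v -> D0 v' -> ((wnorm1 d (v - v'))%:E <= diam D0 d)%E.
Proof. by move=> Dv Dv'; apply: ereal_sup_ubound; exists (v, v'). Qed.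

Lemma diam_ge0 : (0 <= diam D0 d)%E.
Proof.
apply: le_trans (wnorm_le_diam D0_theta D0_theta).
by rewrite lee_fin wnorm1_ge0.
Qed.

Lemma phi_ge0 : (0 <= phi D0 m Fm Fm1 d)%E.
Proof.
rewrite /phi le_min lee_fin !mulr_ge0 ?Fm_ge0//=.
by rewrite mule_ge0 ?diam_ge0// lee_fin L_ge0.
Qed.

Lemma phi_fin_num : phi D0 m Fm Fm1 d \is a fin_num.
Proof.
rewrite ge0_fin_numE ?phi_ge0// (@le_lt_trans _ _ (2 * Fm / m`!%:R)%:E) ?ltry//.
by rewrite /phi ge_min lexx.
Qed.

Let phir : R := fine (phi D0 m Fm Fm1 d).

Lemma phir_ge0 : 0 <= phir. Proof. exact/fine_ge0/phi_ge0. Qed.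

(** The two members of the minimum in [phi] are the bound by Fm and the bound by L times the
    distance from theta, which is at most the diameter. *)
Lemma rho_le_phi w i v : T0 w -> D0 v -> `|rho i v (W i w)| <= phir.
Proof.
move=> Tw Dv; rewrite -lee_fin /phir fineK ?phi_fin_num// /phi le_min lee_fin rho_le//=.
apply: (@le_trans _ _ (L%:E * (wnorm1 d (v - theta))%:E)%E).
  rewrite -EFinM lee_fin (le_trans (rho_leL _ Tw Dv))// ler_wpM2l ?L_ge0//.
  by rewrite linB; exact: norm_lin_le.
by apply: lee_wpmul2l; [rewrite lee_fin L_ge0|exact: wnorm_le_diam].
Qed.

Lemma f_le_phi w J i v : T0 w -> D0 v -> `|f J i v (W i w)| <= phir * `|wt J i (W i w)|.
Proof. by move=> Tw Dv; rewrite normrM ler_wpM2r// rho_le_phi. Qed.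

Lemma finite_expectation_f J i v : D0 v -> finite_expectation P (f J i v \o W i).
Proof.
move=> Dv; apply: (@finite_expectation_bounded _ _ _ _ T0 _ phir) => //.
  exact: (measurableT_comp (measurable_f J i v) (measurable_W i)).
move=> w Tw /=; rewrite (le_trans (f_le_phi _ _ Tw Dv))//.
by rewrite -[leRHS]mulr1 ler_wpM2l ?phir_ge0 ?wt_le1.
Qed.

Let Sx J v w : R := \sum_i (f J i v (W i w) - mean P (f J i v \o W i)).

Lemma rem_f w i v : T0 w -> D0 v ->
  rem i v (W i w) = \sum_(J : {ffun 'I_m -> 'I_p}) (\prod_l u v (J l)) * f J i v (W i w).
Proof.
move=> Tw Dv; rewrite rem_rho// (lin_eta i) exprn_sum_ffun big_distrr /=.
apply: eq_bigr => J _; rewrite big_split /= /f /wt; ring.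
Qed.

Lemma sum_rem w v : T0 w -> D0 v ->
  \sum_i (rem i v (W i w) - mean P (rem i v \o W i)) =
  \sum_(J : {ffun 'I_m -> 'I_p}) (\prod_l u v (J l)) * Sx J v w.
Proof.
move=> Tw Dv; under [RHS]eq_bigr do rewrite big_distrr /=.
rewrite exchange_big /=; apply: eq_bigr => i _.
under [RHS]eq_bigr do rewrite mulrBr.
rewrite sumrB -rem_f//; congr (_ - _).
transitivity (\sum_(J : {ffun 'I_m -> 'I_p})
    mean P (fun w' => (\prod_l u v (J l)) * (f J i v \o W i) w')); last first.
  by apply: eq_bigr => J _; apply: meanZ; exact: finite_expectation_f.
rewrite -mean_sum => [|J]; last by apply: finite_expectationZ; exact: finite_expectation_f.
by apply: mean_ae; apply: (ae_full T0_meas PT0) => w' Tw' /=; exact: rem_f.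
Qed.

Lemma norm_sum_rem_le w v t : T0 w -> D0 v -> 0 <= t -> (forall J, `|Sx J v w| <= t) ->
  `|\sum_i (rem i v (W i w) - mean P (rem i v \o W i))| <= t * wnorm1 d (v - theta) ^+ m.
Proof.
move=> Tw Dv t0 St; rewrite sum_rem// -sum_norm_u exprn_sum_ffun big_distrr /=.
apply: le_trans (ler_norm_sum _ _ _) _; apply: ler_sum => J _.
by rewrite normrM normr_prod mulrC ler_wpM2r// prodr_ge0.
Qed.

(* Equal to [0] outside [T0], and also at [v = theta] when [m > 0], since [x / 0 = 0]. *)
Definition remainder_process (v : 'cV[R]_p) (w : Omega) : R :=
  \1_T0 w * ((\sum_i (rem i v (W i w) - mean P (rem i v \o W i))) /
              wnorm1 d (v - theta) ^+ m).

Let xi := remainder_process.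

Lemma measurable_xi v : measurable_fun setT (xi v).
Proof.
apply: measurable_funM; first exact: measurable_indic.
apply: measurable_funM => //; apply: measurable_sum => i; apply: measurable_funB => //.
exact: (measurableT_comp (measurable_rem i v) (measurable_W i)).
Qed.

Lemma xi_out w v : ~ T0 w -> xi v w = 0.
Proof. by move=> Tw; rewrite /xi /remainder_process indicE memNset// mul0r. Qed.

Lemma norm_xi_le w v t : D0 v -> 0 <= t -> (forall J, `|Sx J v w| <= t) -> `|xi v w| <= t.
Proof.
move=> Dv t0 St; have [Tw|nTw] := pselect (T0 w); last by rewrite xi_out// normr0.
rewrite /xi /remainder_process indicE mem_set// mul1r normrM normfV.
have wn0 : 0 <= wnorm1 d (v - theta) ^+ m by rewrite exprn_ge0// wnorm1_ge0.
rewrite (ger0_norm wn0); have [->|wn] := eqVneq (wnorm1 d (v - theta) ^+ m) 0.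
  by rewrite invr0 mulr0.
by rewrite ler_pdivrMr ?lt_def ?wn// norm_sum_rem_le.
Qed.

(** Where the normalizing factor is 0 the quotient carries no information, but there
    [norm_sum_rem_le] forces the centered sum of remainders to vanish. *)
Lemma xi_wnorm w v : T0 w -> D0 v -> xi v w * wnorm1 d (v - theta) ^+ m =
  \sum_i (rem i v (W i w) - mean P (rem i v \o W i)).
Proof.
move=> Tw Dv; rewrite /xi /remainder_process indicE mem_set// mul1r.
have [wn|wn] := eqVneq (wnorm1 d (v - theta) ^+ m) 0; last by rewrite divfK.
rewrite wn mulr0; apply/esym/eqP; rewrite -normr_le0.
pose t := \big[Num.max/0]_(J : {ffun 'I_m -> 'I_p}) `|Sx J v w|.
rewrite (le_trans (norm_sum_rem_le (t := t) Tw Dv _ _)) ?wn ?mulr0//.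
  exact: bigmax_ge_id.
by move=> J; exact: (le_bigmax _ (fun J => `|Sx J v w|)).
Qed.

(** * The Taylor identities in scalar and tensor form *)

Lemma gamma_taylor_sum w v : T0 w -> D0 v ->
  gamma_sum Y Z gamma h v w =
  taylor_sum Y Z gamma h m theta v w + xi v w * wnorm1 d (v - theta) ^+ m.
Proof.
move=> Tw Dv; rewrite xi_wnorm//.
have [F1 F2 _] := Hexp.
pose X k i w := dgamma gamma k i (dotv (h (Z i w)) theta) (Y i w) *
  dotv (h (Z i w)) (v - theta) ^+ k.
have -> : taylor_sum Y Z gamma h m theta v w = \sum_i \sum_(k < m.+1)
    k`!%:R^-1 * (X k i w - mean P (X k i)).
  by rewrite exchange_big /=; apply: eq_bigr => k _; rewrite big_distrr.
rewrite -big_split /=; apply: eq_bigr => i _; rewrite /centered -/(mean P _).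
have FX (k : 'I_m.+1) : finite_expectation P (X k i) by apply: F2 => //; rewrite -ltnS.
have FkX (k : 'I_m.+1) : finite_expectation P (fun w => k`!%:R^-1 * X k i w).
  exact: finite_expectationZ.
have remX w' : T0 w' -> rem i v (W i w') = gamma i (dotv (h (Z i w')) v) (Y i w') +
    (-1) * \sum_(k < m.+1) k`!%:R^-1 * X k i w'.
  move=> Tw'; rewrite /rem derE// mulN1r; congr (_ - _); apply: eq_bigr => k _.
  by rewrite derE// -ltnS.
have -> : mean P (rem i v \o W i) =
    mean P (fun w => gamma i (dotv (h (Z i w)) v) (Y i w)) +
    (-1) * \sum_(k < m.+1) k`!%:R^-1 * mean P (X k i).
  rewrite (mean_ae (ae_full T0_meas PT0 remX)).
  have FS := finite_expectation_sum (index_enum 'I_m.+1) FkX.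
  rewrite (meanD (F1 i v Dv) (finite_expectationZ (-1) FS)) meanZ// mean_sum//.
  by congr (_ + _ * _); apply: eq_bigr => k _; rewrite meanZ.
rewrite remX//; under [in RHS]eq_bigr do rewrite mulrBr.
rewrite sumrB; ring.
Qed.

Lemma taylor_tensor_sum w v : D0 v ->
  taylor_sum Y Z gamma h m theta v w = tensor_taylor_sum Y Z gamma h m theta v w.
Proof.
move=> Dv; have [_ _ F3] := Hexp.
apply: eq_bigr => k _; congr (_ * _); apply: eq_bigr => i _.
pose c w := dgamma gamma k i (dotv (h (Z i w)) theta) (Y i w).
pose T J w := c w * tensor_pow (h (Z i w)) k J 0.
pose U := tensor_pow (v - theta) k.
have FT J : finite_expectation P (T J) by apply: F3; rewrite -ltnS.
have E w' : c w' * dotv (h (Z i w')) (v - theta) ^+ k = \sum_J U J 0 * T J w'.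
  rewrite -dotv_tensor_pow dotvE big_distrr /=; apply: eq_bigr => J _.
  by rewrite /T mulrA mulrC.
rewrite /centered -/(mean P _) (E w).
have -> : mean P (fun w => c w * dotv (h (Z i w)) (v - theta) ^+ k) =
    \sum_J U J 0 * mean P (T J).
  rewrite (_ : (fun w => _) = fun w => \sum_J U J 0 * T J w); last exact/funext.
  rewrite mean_sum => [|J]; last exact: finite_expectationZ.
  by apply: eq_bigr => J _; rewrite meanZ.
rewrite -sumrB dotvE; apply: eq_bigr => J _.
rewrite /centeredv mxE /centered -/(mean P _) !mxE -mulrBr mulrC; congr (_ * _).
by congr (_ - mean P _); apply/funext => w'; rewrite mxE.
Qed.

(** * Comparison of the thresholds *)

Lemma L_le_psi : L <= psi m Fm1.
Proof.
rewrite /L /psi; case: eqP => [->|_]; first by rewrite !factS fact0.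
rewrite ler_wpM2l ?Fm1_ge0// lef_pV2 ?posrE ?ltr0n ?fact_gt0//.
by rewrite ler_nat factS leq_pmull.
Qed.

Lemma finite_expectation_max_power_sum : finite_expectation P (max_power_sum Z h d (2 * m)).
Proof.
apply: (@finite_expectation_bounded _ _ _ _ T0 _ n.+1%:R) => //.
  apply: measurable_bigmax => j; apply: measurable_sum => i.
  apply: measurable_funX.
  exact: (measurableT_comp (measurable_eta i j) (measurable_W i)).
move=> w Tw; rewrite ger0_norm; last exact: bigmax_ge_id.
apply: bigmax_le => // j _.
have -> : n.+1%:R = \sum_(i < n.+1) 1 :> R by rewrite sumr_const card_ord.
apply: ler_sum => i _; apply: le_trans (ler_norm _) _.
by rewrite normrX exprn_ile1// (eta_le1 i j Tw).
Qed.

(** By AM-GM the product over l of the squares of [eta] is at most the mean over l of their m-th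
    powers. After summing over i, each l contributes at most the maximum over j. *)
Lemma sum_wt_sq_le J w : \sum_i wt J i (W i w) ^+ 2 <= max_power_sum Z h d (2 * m) w.
Proof.
pose y i l := eta i (J l) (W i w) ^+ 2.
have le_max j : \sum_i eta i j (W i w) ^+ (2 * m) <= max_power_sum Z h d (2 * m) w.
  exact: (le_bigmax _ (fun j => \sum_(i < n.+1) (h (Z i w) j 0 / d j) ^+ (2 * m))).
have wty i : wt J i (W i w) ^+ 2 = \prod_l y i l by rewrite /wt -prodrXl.
(* For m = 0 there is nothing to average; both sides count the variables because x^0 = 1, and an
   index j exists since p > 0. *)
case: (posnP m) => [m0|m0].
  apply: le_trans (le_max (Ordinal p_gt0)); apply: ler_sum => i _.
  have -> : (2 * m = 0)%N by rewrite m0.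
  rewrite wty expr0 big1// => l; have := ltn_ord l; by rewrite [X in (_ < X)%N]m0.
apply: (@le_trans _ _ (\sum_i m%:R^-1 * \sum_l y i l ^+ m)).
  apply: ler_sum => i _; rewrite wty; apply: prod_le_mean_pow => // l; exact: sqr_ge0.
rewrite -big_distrr exchange_big /= ler_pdivrMl ?ltr0n//.
apply: (@le_trans _ _ (\sum_(l < m) max_power_sum Z h d (2 * m) w)).
  apply: ler_sum => l _; apply: le_trans (le_max (J l)).
  by apply: ler_sum => i _; rewrite /y -exprM.
by rewrite sumr_const card_ord mulr_natl.
Qed.

Lemma wt_var_le J : wt_var P W (wt J) <= mean P (max_power_sum Z h d (2 * m)).
Proof.
have F i : finite_expectation P (fun w => wt J i (W i w) ^+ 2).
  apply: (@finite_expectation_bounded _ _ _ _ T0 _ 1) => //.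
    apply: measurable_funX; exact: (measurableT_comp (measurable_wt J i) (measurable_W i)).
  by move=> w Tw; rewrite normrX exprn_ile1// wt_le1.
rewrite /wt_var -mean_sum//; apply: le_mean.
- exact: finite_expectation_sum.
- exact: finite_expectation_max_power_sum.
- by apply: aeW => w; exact: sum_wt_sq_le.
Qed.

(** The threshold of [centered_sup_tail], with a real radius [D] in place of the diameter, which may
    be +oo. *)
Definition real_threshold (D x : R) J : R :=
  8 * L * D * Num.sqrt (2 * ln (2 * p%:R)) * mean P (eta_norm W eta)
  + phir * Num.sqrt (wt_var P W (wt J)) * Num.sqrt (2 * x) + 8 * phir * x.

Lemma mean_eta_norm_ge0 : 0 <= mean P (eta_norm W eta).
Proof. by apply: mean_ge0; apply: aeW => w; exact: sqrtr_ge0. Qed.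

Lemma real_threshold_ge0 D x J : 0 <= D -> 0 <= x -> 0 <= real_threshold D x J.
Proof.
move=> D_ge0 x0; have := mean_eta_norm_ge0; have := phir_ge0 => *.
by apply: addr_ge0; [apply: addr_ge0|]; rewrite ?mulr_ge0 ?sqrtr_ge0 ?Fm1_ge0.
Qed.

Lemma real_threshold_le D (q : R) J : 0 <= D -> (D%:E <= diam D0 d)%E ->
  0 <= ln (p%:R ^+ m / q) ->
  ((real_threshold D (ln (p%:R ^+ m / q)) J)%:E <= tail_threshold Z h D0 m Fm Fm1 d q)%E.
Proof.
move=> D_ge0 Dd; set x := ln _ => x0; rewrite /real_threshold /tail_threshold -/x !EFinD.
apply: leeD; first apply: leeD.
- set c := Num.sqrt _; set M := mean P _.
  have EA : ('E_P[fun w => Num.sqrt (max_power_sum Z h d 2 w)] = M%:E)%E.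
    rewrite /M /mean fineK//; apply: finite_expectation_fin_num.
    apply: (finite_expectation_eta_norm measurable_W T0_meas PT0) => //.
      exact: measurable_eta.
    by move=> i j w; exact: eta_le1.
  rewrite /constA EA; have -> : 8 * L * D * c * M = 8 * L * D * M * c by ring.
  rewrite EFinM; apply: lee_wpmul2r; first by rewrite lee_fin sqrtr_ge0.
  rewrite EFinM; apply: lee_wpmul2r; first by rewrite lee_fin mean_eta_norm_ge0.
  rewrite EFinM; apply: lee_pmul => //; rewrite lee_fin.
    by apply: mulr_ge0 => //; exact: L_ge0.
  by rewrite ler_wpM2l// L_le_psi.
- rewrite /constB EFinM; apply: lee_wpmul2r; first by rewrite lee_fin sqrtr_ge0.
  rewrite EFinM /phir fineK ?phi_fin_num//; apply: lee_wpmul2l; first exact: phi_ge0.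
  rewrite -(fineK (finite_expectation_fin_num finite_expectation_max_power_sum)) /=.
  by rewrite lee_fin ler_wsqrtr// wt_var_le.
- rewrite /constC EFinM; apply: lee_wpmul2r; first by rewrite lee_fin.
  by rewrite EFinM /phir fineK ?phi_fin_num.
Qed.

Lemma tail_threshold_ge0 q : 0 <= ln (p%:R ^+ m / q) ->
  (0 <= tail_threshold Z h D0 m Fm Fm1 d q)%E.
Proof.
move=> x0; pose J : {ffun 'I_m -> 'I_p} := [ffun=> Ordinal p_gt0].
(* The comparison is used with radius D = 0 and an arbitrary multi-index. *)
apply: le_trans (real_threshold_le J (lexx 0) diam_ge0 x0).
by rewrite lee_fin real_threshold_ge0.
Qed.

Lemma ln_ratio_gt0 q : 0 < q < 1 -> 0 < ln (p%:R ^+ m / q) :> R.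
Proof.
move=> /andP[q0 q1]; rewrite ln_gt0// ltr_pdivlMr// mul1r (lt_le_trans q1)//.
by rewrite exprn_ege1// ler1n.
Qed.

(** * Tail bound over finitely many parameter values *)

Lemma measurable_gt_eset (c : \bar R) v : measurable [set w | (c < `|xi v w|%:E)%E].
Proof.
have mxi : measurable_fun setT (fun w => `|xi v w|%:E).
  apply/measurable_EFinP; apply: (@measurableT_comp _ _ _ _ _ _ (@Num.norm R R)) => //.
  exact: measurable_xi.
rewrite -[X in measurable X]setTI.
have -> : [set w | (c < `|xi v w|%:E)%E] = (fun w => `|xi v w|%:E) @^-1` `]c, +oo[%classic.
  by apply/seteqP; split=> w /=; rewrite in_itv /= ?andbT// ltry => ->.
by apply: mxi => //; exact: emeasurable_itv.
Qed.

Lemma finite_union_bound (K : eqType) (s : seq K) (F : K -> set Omega) :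
  (forall J, measurable (F J)) ->
  (P [set w | exists2 J, J \in s & F J w] <= \sum_(J <- s) P (F J))%E /\
  measurable [set w | exists2 J, J \in s & F J w].
Proof.
move=> mF; elim: s => [|J s [IH mIH]].
  rewrite big_nil (_ : [set w | _] = set0) ?measure0//.
  by apply/seteqP; split=> w //= -[].
rewrite big_cons (_ : [set w | exists2 J', J' \in J :: s & F J' w] =
   F J `|` [set w | exists2 J', J' \in s & F J' w]); last first.
  apply/seteqP; split=> w /=.
    by move=> [J']; rewrite inE => /predU1P[->|Js] FJ; [left|right; exists J'].
  by move=> [FJ|[J' Js FJ]]; [exists J|exists J'] => //; rewrite inE ?eqxx ?Js ?orbT.
split; last exact: measurableU.
by apply: le_trans (measureU2 _ _ _) _ => //; apply: leeD.
Qed.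

Lemma finite_sup_tail k (vs : 'I_k.+1 -> 'cV[R]_p) q : (forall i, D0 (vs i)) -> 0 < q < 1 ->
  (P [set w | exists i, (tail_threshold Z h D0 m Fm Fm1 d q < `|xi (vs i) w|%:E)%E]
   <= q%:E)%E.
Proof.
move=> Dvs q01; have x0 := ln_ratio_gt0 q01; case/andP: (q01) => q0 _.
set x := ln _ in x0.
(* Only distances from theta enter [u], so the radius of finitely many points around theta suffices;
   it is finite and at most the diameter. *)
pose D : R := \big[Num.max/0]_i wnorm1 d (vs i - theta).
have D_ge0 : 0 <= D by exact: bigmax_ge_id.
have Dd : (D%:E <= diam D0 d)%E.
  rewrite /D; apply: (big_ind (fun y : R => (y%:E <= diam D0 d)%E)).
  - exact: diam_ge0.
  - by move=> y z; rewrite /Num.max; case: ifP.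
  - by move=> i _; exact: wnorm_le_diam.
pose F J := [set w | (real_threshold D x J < centered_sup P W (fun i l => f J i (vs l)) w)%R].
have mF J : measurable (F J).
  apply: measurable_gt_set; apply: measurable_centered_sup; first exact: measurable_W.
  by move=> i l; exact: measurable_f.
have PF J : (P (F J) <= (expR (- x))%:E)%E.
  apply: (@centered_sup_tail _ _ _ _ _ P n p W _ measurable_W YZ_indep T0 T0_meas PT0
    (fun i l => f J i (vs l)) eta (wt J) (fun l => u (vs l)) L D phir) => //.
  - by move=> i l; exact: measurable_f.
  - exact: measurable_eta.
  - by move=> i; exact: measurable_wt.
  - exact: L_ge0.
  - exact: phir_ge0.
  - move=> i l w Tw; rewrite -lin_eta normrM -[leRHS]mulr1.
    by apply: ler_pM => //; [exact: rho_leL|exact: wt_le1].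
  - move=> i l l' w Tw; rewrite -!lin_eta !linB opprB addrA subrK.
    rewrite -mulrBl normrM -[leRHS]mulr1.
    by apply: ler_pM => //; [exact: rho_lip|exact: wt_le1].
  - by move=> i l w Tw; exact: f_le_phi.
  - by move=> i w Tw; exact: wt_le1.
  - by move=> i j w Tw; exact: eta_le1.
  - move=> l; rewrite sum_norm_u.
    exact: (le_bigmax _ (fun i => wnorm1 d (vs i - theta))).
have [ub mub] := finite_union_bound (index_enum {ffun 'I_m -> 'I_p}) mF.
apply: (@le_trans _ _ (\sum_(J : {ffun 'I_m -> 'I_p}) (expR (- x))%:E)%E); last first.
  rewrite sumEFin lee_fin sumr_const card_ffun !card_ord -mulr_natl natrX.
  rewrite expRN /x lnK ?posrE ?divr_gt0 ?exprn_gt0 ?ltr0n//.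
  by rewrite invf_div mulrC divfK// expf_neq0// pnatr_eq0 -lt0n.
apply: le_trans (le_trans ub (lee_sum _ (fun J _ => PF J))).
apply: le_measure; rewrite ?inE//.
  rewrite (_ : [set w | _] = \bigcup_(i in [set: 'I_k.+1])
     [set w | (tail_threshold Z h D0 m Fm Fm1 d q < `|xi (vs i) w|%:E)%E]).
    by apply: fin_bigcup_measurable => //= i _; exact: measurable_gt_eset.
  by apply/seteqP; split=> w /= [i]; [exists i|move=> _; exists i].
move=> w /= [i thr]; apply: contrapT => nJ.
(* If no multi-index exceeds its threshold, the largest threshold t bounds every |Sx J|, hence |xi|,
   against the assumption on w. *)
pose t := \big[Num.max/0]_(J : {ffun 'I_m -> 'I_p}) real_threshold D x J.
have : (`|xi (vs i) w|%:E <= tail_threshold Z h D0 m Fm Fm1 d q)%E.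
  apply: (@le_trans _ _ t%:E).
    rewrite lee_fin; apply: norm_xi_le => //; first exact: bigmax_ge_id.
    move=> J; apply: le_trans (le_bigmax _ (fun J => real_threshold D x J) J).
    rewrite leNgt; apply/negP => SJ; apply: nJ; exists J; first by rewrite mem_index_enum.
    apply: lt_le_trans SJ _; rewrite /centered_sup.
    by have := supn_ge [ffun l => \sum_i (f J i (vs l) (W i w) - mean P (f J i (vs l) \o W i))] i;
      rewrite ffunE.
  rewrite /t; apply: (big_ind (fun y : R => (y%:E <= tail_threshold Z h D0 m Fm Fm1 d q)%E)).
  - exact/tail_threshold_ge0/ltW.
  - by move=> y z; rewrite /Num.max; case: ifP.
  - by move=> J _; apply: real_threshold_le => //; exact: ltW.
by rewrite leNgt thr.
Qed.

(** * From finitely many parameter values to all of D0 *)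

Lemma norm_Sx_le w J v v' : T0 w -> D0 v -> D0 v' ->
  `|Sx J v w - Sx J v' w| <= n.+1%:R * (2 * (L * wnorm1 d (v - v'))).
Proof.
move=> Tw Dv Dv'; rewrite /Sx -sumrB.
have -> : n.+1%:R * (2 * (L * wnorm1 d (v - v'))) =
    \sum_(i < n.+1) 2 * (L * wnorm1 d (v - v')) by rewrite sumr_const card_ord mulr_natl.
apply: le_trans (ler_norm_sum _ _ _) _; apply: ler_sum => i _.
have fl w' : T0 w' -> `|f J i v (W i w') - f J i v' (W i w')| <= L * wnorm1 d (v - v').
  move=> Tw'; rewrite /f -mulrBl normrM -[leRHS]mulr1.
  apply: ler_pM => //; last exact: wt_le1.
  apply: le_trans (rho_lip _ Tw' Dv Dv') _; rewrite ler_wpM2l ?L_ge0//.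
  exact: norm_lin_le.
rewrite opprD opprK addrACA mulr_natl mulr2n (le_trans (ler_normD _ _))// lerD ?fl//.
rewrite addrC distrC; apply: norm_mean_le; [exact: finite_expectation_f..|].
exact: (ae_full T0_meas PT0).
Qed.

Lemma cvg_xi w v (vn : nat -> 'cV[R]_p) : T0 w -> D0 v -> (forall k, D0 (vn k)) ->
  (forall j, vn k j 0 @[k --> \oo] --> v j 0) -> wnorm1 d (v - theta) ^+ m != 0 ->
  xi (vn k) w @[k --> \oo] --> xi v w.
Proof.
move=> Tw Dv Dvn vnv wn.
have cu j : u (vn k) j @[k --> \oo] --> u v j.
  rewrite /u; apply: cvgMr; rewrite !mxE.
  under eq_fun do rewrite !mxE.
  exact: cvgB (vnv j) (cvg_cst _).
have cw : wnorm1 d (vn k - theta) @[k --> \oo] --> wnorm1 d (v - theta).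
  rewrite -sum_norm_u; under eq_fun do rewrite -sum_norm_u.
  by apply: cvg_sum_seq => j; apply: cvg_norm; exact: cu.
have cw0 : wnorm1 d (vn k - v) @[k --> \oo] --> (0 : R).
  have -> : (0 : R) = \sum_(j < p) d j * `|v j 0 - v j 0|.
    by rewrite big1// => j _; rewrite subrr normr0 mulr0.
  have wE k : wnorm1 d (vn k - v) = \sum_(j < p) d j * `|vn k j 0 - v j 0|.
    by apply: eq_bigr => j _; rewrite !mxE.
  under eq_fun do rewrite wE.
  apply: (cvg_sum_seq (F := fun j k => d j * `|vn k j 0 - v j 0|)) => j.
  apply: cvgMr; apply: cvg_norm; exact: cvgB (vnv j) (cvg_cst _).
have cS J : Sx J (vn k) w @[k --> \oo] --> Sx J v w.
  have c0 : n.+1%:R * (2 * (L * wnorm1 d (vn k - v))) @[k --> \oo] --> (0 : R).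
    have -> : (0 : R) = n.+1%:R * (2 * (L * 0)) by rewrite !mulr0.
    by do 3 apply: cvgMr.
  apply/cvgrPdist_lt => e e0; apply: filterS (cvgr_lt _ c0 _ e0) => k.
  by apply: le_lt_trans; rewrite distrC; exact: norm_Sx_le.
rewrite /xi /remainder_process; apply: cvgMr; apply: cvgM; last first.
  by apply: cvgV => //; exact: (continuous_cvg _ (@exprn_continuous R m _) cw).
rewrite sum_rem//; under eq_fun do rewrite sum_rem//.
apply: cvg_sum_seq => J; apply: cvgM => //.
by apply: cvg_prod_seq => l; exact: cu.
Qed.

Lemma xi_theta w v : D0 v -> wnorm1 d (v - theta) ^+ m = 0 -> xi v w = 0.
Proof. by move=> Dv wn; rewrite /xi /remainder_process wn invr0 !mulr0. Qed.

(** Continuity of xi is known only on [T0] and where the normalizing factor is nonzero, but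
    everywhere else xi is 0 and cannot exceed c >= 0. At the remaining points the strict inequality
    persists along a sequence from the dense set. *)
Lemma sup_gt_dense (vs : nat -> 'cV[R]_p) (c : \bar R) w : (0 <= c)%E ->
  (forall k, D0 (vs k)) ->
  (forall v e, D0 v -> 0 < e -> exists k, forall j, `|vs k j 0 - v j 0| < e) ->
  (c < ereal_sup [set `|xi v w|%:E | v in D0])%E <-> exists k, (c < `|xi (vs k) w|%:E)%E.
Proof.
move=> c0 Dvs dense; split=> [|[k ck]]; last first.
  by apply: lt_le_trans ck _; apply: ereal_sup_ubound; exists (vs k).
case/ereal_sup_gt => _ [v Dv <-] cv.
have xi0 : xi v w != 0.
  by apply/eqP => xi0; move: cv; rewrite xi0 normr0 ltNge c0.
have Tw : T0 w by apply: contrapT => nTw; move/eqP: xi0; apply; exact: xi_out.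
have wn : wnorm1 d (v - theta) ^+ m != 0.
  by apply/eqP => wn; move/eqP: xi0; apply; exact: xi_theta.
have /choice[sg sgP] : forall k, exists l, forall j, `|vs l j 0 - v j 0| < k.+1%:R^-1.
  by move=> k; apply: dense.
have cv0 : xi (vs (sg k)) w @[k --> \oo] --> xi v w.
  apply: cvg_xi => // j; apply/cvgrPdist_lt => e e0.
  apply: filterS (near_infty_natSinv_lt (PosNum e0)) => k.
  by apply: lt_trans; rewrite distrC; exact: sgP.
case: c c0 cv => [r| |]// r0; rewrite lte_fin => rv.
have [k _ hk] := cvgr_gt _ (cvg_norm cv0) _ rv.
by exists (sg k); rewrite lte_fin; exact: (hk k (leqnn k)).
Qed.

Lemma sup_tail q : 0 < q < 1 ->
  let E := [set w | (tail_threshold Z h D0 m Fm Fm1 d q <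
    ereal_sup [set `|xi v w|%:E | v in D0])%E] in
  measurable E /\ (P E <= q%:E)%E.
Proof.
move=> q01; set c := tail_threshold _ _ _ _ _ _ _ _ => E.
have c0 : (0 <= c)%E by apply/tail_threshold_ge0/ltW/ln_ratio_gt0.
have [vs [Dvs dense]] := dense_sequence (ex_intro _ theta D0_theta).
pose F k := [set w | exists i : 'I_k.+1, (c < `|xi (vs i) w|%:E)%E].
have mF k : measurable (F k).
  rewrite (_ : F k = \bigcup_(i in [set: 'I_k.+1]) [set w | (c < `|xi (vs i) w|%:E)%E]).
    by apply: fin_bigcup_measurable => //= i _; exact: measurable_gt_eset.
  by apply/seteqP; split=> w /= [i]; [exists i|move=> _; exists i].
have EF : E = \bigcup_k F k.
  apply/seteqP; split=> w.
    by move=> /(sup_gt_dense w c0 Dvs dense)[k ck]; exists k => //; exists ord_max.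
  by move=> [k _ [i ci]]; apply/(sup_gt_dense w c0 Dvs dense); exists i.
rewrite EF; split; first exact: bigcupT_measurable.
have cv : P (F k) @[k --> \oo] --> P (\bigcup_k F k).
  apply: nondecreasing_cvg_mu => //; first exact: bigcupT_measurable.
  move=> k l kl; apply/subsetPset => w [i ci].
  by exists (widen_ord (kl : (k.+1 <= l.+1)%N) i).
rewrite -(cvg_lim _ cv)//; apply: lime_le; first by apply/cvg_ex; eexists; exact: cv.
by apply: nearW => k; exact: (@finite_sup_tail k (fun i => vs i)).
Qed.

End remainder_process.

Theorem theorem2p1 (R : realType) (dO dY dZ : measure_display)
  (Omega : measurableType dO) (Ys : measurableType dY) (Zs : measurableType dZ)
  (P : probability Omega R) (N p : nat)
  (N_gt0 : (0 < N)%N) (p_gt0 : (0 < p)%N)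
  (Y : 'I_N -> {RV P >-> Ys}) (Z : 'I_N -> {RV P >-> Zs})
  (YZ_indep : mutually_independent P (fun i w => (Y i w, Z i w)))
  (gamma : 'I_N -> R -> Ys -> R)
  (gamma_meas : forall i t, measurable_fun setT (gamma i t))
  (h : Zs -> 'cV[R]_p)
  (h_meas : forall j, measurable_fun setT (fun z => h z j 0))
  (D0 : set 'cV[R]_p) (m : nat) (a b : 'I_N -> \bar R) (Fm Fm1 : R)
  (d : 'I_p -> R)
  (Hreg : regularity Y gamma m a b Fm Fm1)
  (Hbnd : boundedness Z h d)
  (Hdom : parameter_domain Z h D0 a b)
  (theta : 'cV[R]_p) (D0_theta : D0 theta)
  (Hexp : finite_expectations Y Z gamma h D0 m theta) :
  exists xi : 'cV[R]_p -> Omega -> R,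
    [/\ forall v, D0 v -> measurable_fun setT (xi v),
        {ae P, forall w, forall v, D0 v ->
          gamma_sum Y Z gamma h v w =
            taylor_sum Y Z gamma h m theta v w
            + xi v w * wnorm1 d (v - theta) ^+ m
          /\
          taylor_sum Y Z gamma h m theta v w
            + xi v w * wnorm1 d (v - theta) ^+ m =
            tensor_taylor_sum Y Z gamma h m theta v w
            + xi v w * wnorm1 d (v - theta) ^+ m}
      & forall q : R, 0 < q < 1 ->
          let E := [set w |
            (tail_threshold Z h D0 m Fm Fm1 d q <
             ereal_sup [set `|xi v w|%:E | v in D0])%E] in
          measurable E /\ (P E <= q%:E)%E].
Proof.
(* With N > 0 the index type has the form 'I_n.+1 that [inord] needs. *)
case: N N_gt0 Y Z YZ_indep gamma gamma_meas a b Hreg Hbnd Hdom Hexp => // n _ Y Z.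
move=> YZ_indep gamma gamma_meas a b Hreg Hbnd Hdom Hexp.
have [T0 [mT0 PT0 good]] := good_event Hreg Hbnd Hdom.
exists (remainder_process Y Z gamma h m d theta T0); split.
- by move=> v _; exact: measurable_xi.
- apply: (ae_full mT0 PT0) => w Tw v Dv; split; last by rewrite (taylor_tensor_sum Hexp).
  exact: (gamma_taylor_sum gamma_meas h_meas Hreg Hbnd D0_theta Hexp mT0 PT0 good).
- move=> q q01.
  exact: (sup_tail p_gt0 YZ_indep gamma_meas h_meas Hreg Hbnd D0_theta mT0 PT0 good).
Qed.
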